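(* Let $L>0$, $0\le\mu<L$, $N\ge 1$, put $q=\mu/L$, and let $w=(w_x,w_f,w_g)$ satisfy $w_x,w_f,w_g\ge 0$ and $w_x+w_f+w_g=1$. Assume that either $q>0$ or $w_x>0$. Then there is a unique risk coefficient for $w$ (in the sense defined in the context, for the given $N$ and $q$); denote it by $\eta_N^\star(q,w)$. For every $R>0$ and every $d\ge 2N+1$, $$\mathscr R_N\bigl(\mathcal P^{\mu,L}_{w,R}(\mathbb R^d)\bigr)=\frac L2\,\eta_N^\star(q,w)\,R^2 .$$ Moreover, the ITEM-w method constructed from $\eta=\eta_N^\star(q,w)$ satisfies the same upper guarantee in every dimension: for every $d\ge1$, every $R>0$ and every $(\mathcal O_f,x_0)\in\mathcal P^{\mu,L}_{w,R}(\mathbb R^d)$, its output $z_N$ satisfies $f(z_N)-f_*\le \frac L2\,\eta_N^\star(q,w)\,R^2$.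
   Context: **Problem class and risk.** For $0\le\mu<L$, $\mathcal F_{\mu,L}(\mathbb R^d)$ is the class of differentiable functions $f:\mathbb R^d\to\mathbb R$ that are $\mu$-strongly convex and have $L$-Lipschitz gradient (Euclidean norm). A problem instance is a pair $(\mathcal O_f,x_0)$ where $f\in\mathcal F_{\mu,L}(\mathbb R^d)$ attains its minimum $f_*=\min f$, $\mathcal O_f(x)=(f(x),\nabla f(x))$ is the first-order oracle, and $x_0\in\mathbb R^d$ is the prescribed initial point. $\mathcal P^{\mu,L}_{w,R}(\mathbb R^d)$ is the set of instances such that for some $x_*\in\operatorname{argmin} f$, $$w_x\|x_0-x_*\|^2+\tfrac{2w_f}{L}(f(x_0)-f_* )+\tfrac{w_g}{L^2}\|\nabla f(x_0)\|^2\le R^2.$$ $\mathcal A_{N,d}$ is the set of deterministic first-order methods that may depend on the parameters defining the problem class and on $(N,d)$, query first at $x_0$, make at most $N$ oracle calls (each adaptively chosen query being a function of the previous oracle answers), and return an arbitrary function of the history of oracle answers. For a set $\mathcal P$ of instances, the minimax risk is $$\mathscr R_N(\mathcal P)=\inf_{\mathcal M\in\mathcal A_{N,d}}\ \sup_{(\mathcal O_f,x_0)\in\mathcal P}\bigl(f(\mathcal M(\mathcal O_f,x_0))-f_*\bigr).$$ **Paired backward sequence.** Fix $N\ge1$, $q\in[0,1)$, $\bar q=1-q$. Given $r\in(0,1)$ set $a_N=r$, $b_N=\sqrt{\bar q}\,r$, and for $k=N,\dots,2$, as long as the quantities are well defined (radicand nonnegative), set $c_k=\sqrt{(1-a_k)(1+\bar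 q+qa_k)}$, $d_k=\bar q+qa_k$, $a_{k-1}=d_ka_k+c_kb_k$, $b_{k-1}=-qc_ka_k+d_kb_k$. The sequence $((a_k,b_k))_{k=1}^N$ is the paired backward sequence associated with $r$; it is ordered if it is well defined through $k=1$ and $1>a_1>\dots>a_N>0$, $b_1>0$. $\mathcal O_N(q)$ is the set of $r\in(0,1)$ whose sequence is ordered. **Risk coefficient.** For $\eta\ge0$ set $r_{\eta,w}^2=q+\eta(\bar q w_x-qw_f)$ and, when this is positive, let $r_{\eta,w}$ be its positive square root. $\eta\geq 0$ is a risk coefficient for $w$ if $r_{\eta,w}\in\mathcal O_N(q)$ and $$a_1+\eta(w_x+w_f)+\sqrt{\eta/\bar q}\;b_1=1,$$ where $(a_1,b_1)$ is the first pair of the backward sequence associated with $r_{\eta,w}$. **ITEM-w associated with $\eta$** (where $\eta>0$, $r_{\eta,w}\in\mathcal O_N(q)$). Take the paired backward sequence $((a_k,b_k))_{k=1}^N$ associated with $r_{\eta,w}$, with $c_k=\sqrt{(1-a_k)(1+\bar q+qa_k)}$ for $2\le k\le N$ and $c_1:=b_1+\sqrt{\bar q\eta}$. Set $z_0=v_{-1}=x_0$. For $k=0,\dots,N-1$: $x_k=z_k+\frac{a_{k+1}}{\bar q(1-a_{k+1})}(z_k-v_{k-1})$; $x_k^+=x_k-L^{-1}\nabla f(x_k)$; $h_k=x_k-x_k^+-q(x_k-z_k)$; $v_k=v_{k-1}-\frac{c_{k+1}}{b_{k+1}}h_k$; $z_{k+1}=(1-a_{k+1})x_k^++a_{k+1}v_k$.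 The output is $z_N$. *)

(* Defs.v *)
From HB Require Import structures.
From mathcomp Require Import all_boot all_order all_algebra.
From mathcomp Require Import all_classical all_reals all_analysis.

Set Implicit Arguments.
Unset Strict Implicit.
Unset Printing Implicit Defensive.

Import Order.TTheory GRing.Theory Num.Theory.
Import numFieldNormedType.Exports.

Local Open Scope classical_set_scope.
Local Open Scope ring_scope.

Section ProblemClass.
Context {K : realType} {d : nat}.
Implicit Types (f : 'rV[K]_d -> K) (x y : 'rV[K]_d).

(* The norm `|x| that the library puts on 'rV[K]_d is the sup norm, whence the
   explicit Euclidean norm. It induces the same topology, so the library's
   [differentiable] is the usual Frechet differentiability on R^d. *)
Definition enorm x : K := Num.sqrt (\sum_(i < d) x ord0 i ^+ 2).

Definition grad f x : 'rV[K]_d := \row_(i < d) 'D_(delta_mx ord0 i) f x.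

Definition strongly_convex (mu : K) f : Prop :=
  forall x y (t : K), 0 <= t <= 1 ->
    f (t *: x + (1 - t) *: y) <=
      t * f x + (1 - t) * f y - mu / 2 * t * (1 - t) * enorm (x - y) ^+ 2.

Definition lipschitz_grad (L : K) f : Prop :=
  forall x y, enorm (grad f x - grad f y) <= L * enorm (x - y).

Definition smooth_strongly_convex (mu L : K) f : Prop :=
  [/\ forall x, differentiable f x, strongly_convex mu f & lipschitz_grad L f].

Definition argmin f : set 'rV[K]_d := [set x | forall y, f x <= f y].

(* Equal to [min f] as soon as [argmin f] is nonempty, which holds for every
   problem instance. *)
Definition fmin f : K := inf (range f).

(* An instance is represented by (f, x0); methods only access f through
   [oracle f], see [ask]. *)
Definition instance_class (mu L wx wf wg R : K) :
    set (('rV[K]_d -> K) * 'rV[K]_d) :=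
  [set p | let: (f, x0) := p in
    smooth_strongly_convex mu L f /\
    exists2 xs, argmin f xs &
      wx * enorm (x0 - xs) ^+ 2 + 2 * wf / L * (f x0 - fmin f)
        + wg / L ^+ 2 * enorm (grad f x0) ^+ 2 <= R ^+ 2].

Definition oracle f x : K * 'rV[K]_d := (f x, grad f x).

End ProblemClass.

(* A method is given the initial point and the oracle answers received so far,
   oldest first. These determine the past query points, so the latter need not
   be recorded. [query] returns [None] to stop before the budget is used up. *)
Record fo_method (K : realType) (d : nat) := FOMethod {
  query : 'rV[K]_d -> seq (K * 'rV[K]_d) -> option 'rV[K]_d;
  output : 'rV[K]_d -> seq (K * 'rV[K]_d) -> 'rV[K]_d
}.

Section Risk.
Context {K : realType} {d : nat}.
Implicit Types (M : fo_method K d) (f : 'rV[K]_d -> K) (x : 'rV[K]_d).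

Definition ask M f x0 (h : seq (K * 'rV[K]_d)) : seq (K * 'rV[K]_d) :=
  if h is [::] then [:: oracle f x0]
  else if query M x0 h is Some y then rcons h (oracle f y) else h.

Definition run (N : nat) M f x0 : 'rV[K]_d :=
  output M x0 (iter N (ask M f x0) [::]).

Definition minimax_risk (N : nat) (P : set (('rV[K]_d -> K) * 'rV[K]_d)) :
    \bar K :=
  ereal_inf (range (fun M : fo_method K d =>
    ereal_sup [set (p.1 (run N M p.1 p.2) - fmin p.1)%:E | p in P])).

End Risk.

Section PairedBackwardSequence.
Context {K : realType}.
Variables (N : nat) (q : K).

Definition radicand (a : K) : K := (1 - a) * (1 + (1 - q) + q * a).

Definition backward_step (ab : K * K) : K * K :=
  let: (a, b) := ab in
  let c := Num.sqrt (radicand a) in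
  let d := (1 - q) + q * a in
  (d * a + c * b, - q * c * a + d * b).

(* (a_k, b_k), meaningful for 1 <= k <= N; [Num.sqrt] is 0 on negative numbers,
   and [ordered] rules this case out. *)
Definition paired (r : K) (k : nat) : K * K :=
  iter (N - k) backward_step (r, Num.sqrt (1 - q) * r).

Definition pa (r : K) (k : nat) : K := (paired r k).1.
Definition pb (r : K) (k : nat) : K := (paired r k).2.

Definition well_defined (r : K) : Prop :=
  forall k, (2 <= k <= N)%N -> 0 <= radicand (pa r k).

Definition ordered (r : K) : Prop :=
  [/\ well_defined r,
      pa r 1 < 1,
      forall k, (1 <= k < N)%N -> pa r k.+1 < pa r k,
      0 < pa r N &
      0 < pb r 1].

Definition ordered_set : set K := [set r | 0 < r < 1 /\ ordered r].

Variables (wx wf : K).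

Definition rsq (eta : K) : K := q + eta * ((1 - q) * wx - q * wf).
Definition rcoef (eta : K) : K := Num.sqrt (rsq eta).

(* The coefficient depends on w_g only through w_x + w_f + w_g = 1. *)
Definition risk_coefficient (eta : K) : Prop :=
  [/\ 0 <= eta, 0 < rsq eta, ordered_set (rcoef eta) &
      pa (rcoef eta) 1 + eta * (wx + wf)
        + Num.sqrt (eta / (1 - q)) * pb (rcoef eta) 1 = 1].

Definition item_c (eta : K) (k : nat) : K :=
  if k == 1%N then pb (rcoef eta) 1 + Num.sqrt ((1 - q) * eta)
  else Num.sqrt (radicand (pa (rcoef eta) k)).

Section Item.
Context {d : nat}.
Variables (L eta : K) (f : 'rV[K]_d -> K) (x0 : 'rV[K]_d).

(* From (z_k, v_{k-1}) to (z_{k+1}, v_k). *)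
Definition item_step (k : nat) (zv : 'rV[K]_d * 'rV[K]_d) :
    'rV[K]_d * 'rV[K]_d :=
  let: (z, v) := zv in
  let a := pa (rcoef eta) k.+1 in
  let b := pb (rcoef eta) k.+1 in
  let c := item_c eta k.+1 in
  let x := z + (a / ((1 - q) * (1 - a))) *: (z - v) in
  let xp := x - L^-1 *: grad f x in
  let h := x - xp - q *: (x - z) in
  let v' := v - (c / b) *: h in
  ((1 - a) *: xp + a *: v', v').

Fixpoint item_iter (k : nat) : 'rV[K]_d * 'rV[K]_d :=
  if k is k'.+1 then item_step k' (item_iter k') else (x0, x0).

Definition item_output : 'rV[K]_d := (item_iter N).1.

End Item.

End PairedBackwardSequence.

(* Main.v *)
Require Import Defs.
From HB Require Import structures.
From mathcomp Require Import all_boot all_order all_algebra.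
From mathcomp Require Import all_classical all_reals all_analysis.
From mathcomp Require Import ring lra.

Import Order.TTheory GRing.Theory Num.Theory.
Import numFieldNormedType.Exports.

Local Open Scope classical_set_scope.
Local Open Scope ring_scope.

(* Scale to L = 1 and put qb = 1 - q. The backward step is a rotation of
   (sqrt q a, b), so q a_k^2 + b_k^2 = r^2 throughout.

   Upper bound: combine the interpolation inequalities between consecutive queries
   (multipliers 1 - a_{k+1}) and between the minimiser and each query (multipliers
   a_k - a_{k+1}). For ITEM-w all quadratic terms telescope and the total defect is
   the single square |grad f(z_N) - r (v_{N-1} - xs)|^2 for the minimiser xs.

   Lower bound: for orthonormal u_0, ..., u_N take f = q/2 |.|^2 plus the Moreau
   envelope of the maximum of affine functions with slopes
   gamma_k u_k + q sum_(l < k) tau_l u_l and one more piece, active at the minimiser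
   - sum_l xi_l u_l. Optimising over gamma, xi, tau by dynamic programming returns
   the paired backward sequence (1 - a_k is the marginal value of gamma_k xi_k).
   A point orthogonal to u_k, ..., u_N sees only the pieces 0, ..., k: the last
   piece is dominated there by a convex combination of those. Hence a resisting
   oracle can hide u_N from any method, and a point orthogonal to u_N has value at
   least the bound.

   Existence of the coefficient is a continuation argument from eta = 0; uniqueness
   follows because every risk coefficient equals the minimax risk. *)

Set Implicit Arguments.
Unset Strict Implicit.
Unset Printing Implicit Defensive.

(** * Euclidean geometry and gradients *)

(** Queries and output are unrestricted, not confined to the span of past gradients. So the
    directions u_k must be produced one at a time, each after the points it has to miss, and every
    oracle answer must stay correct for all later choices. Answers are therefore certified by KKT
    weights carried by few pieces: such weights determine value and gradient without the envelope
    being computed. The number r^2 - q = eta ((1 - q) w_x - q w_f) is the weight that the initial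
    condition, with multiplier eta, puts on each xi_l^2 in the lower bound and on |x_0 - xs|^2 in
    the upper bound. The risk equation is the matching condition at index 1: with y = sqrt((1 - q)
    eta) and c_1 = b_1 + y, it says that a formal backward step from (a_1, b_1) ends at a_0 = 1 -
    eta w_f. Two degeneracies threaten the continuation: w_f may push the radicand of r below zero,
    and r = 0 at the start when q = 0. The bound r^2 >= q a_1 + eta w_x, valid while the defect of
    the equation is nonpositive, controls both. *)

Section Dot.
Context {K : realType} {d : nat}.
Implicit Types (x y z : 'rV[K]_d) (a : K).

Definition dotr x y : K := \sum_(i < d) x ord0 i * y ord0 i.

Lemma dotC x y : dotr x y = dotr y x.
Proof. by apply: eq_bigr => i _; rewrite mulrC. Qed.

Lemma dotDl x y z : dotr (x + y) z = dotr x z + dotr y z.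
Proof. by rewrite -big_split; apply: eq_bigr => i _; rewrite mxE mulrDl. Qed.

Lemma dotZl a x y : dotr (a *: x) y = a * dotr x y.
Proof. by rewrite mulr_sumr; apply: eq_bigr => i _; rewrite mxE mulrA. Qed.

Lemma dotNl x y : dotr (- x) y = - dotr x y.
Proof. by rewrite -scaleN1r dotZl mulN1r. Qed.

Lemma dotBl x y z : dotr (x - y) z = dotr x z - dotr y z.
Proof. by rewrite dotDl dotNl. Qed.

Lemma dot0l x : dotr 0 x = 0.
Proof. by rewrite -(scale0r 0) dotZl mul0r. Qed.

Lemma dotDr x y z : dotr z (x + y) = dotr z x + dotr z y.
Proof. by rewrite dotC dotDl !(dotC z). Qed.

Lemma dotZr a x y : dotr y (a *: x) = a * dotr y x.
Proof. by rewrite dotC dotZl (dotC y). Qed.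

Lemma dotNr x y : dotr y (- x) = - dotr y x.
Proof. by rewrite dotC dotNl (dotC y). Qed.

Lemma dotBr x y z : dotr z (x - y) = dotr z x - dotr z y.
Proof. by rewrite dotDr dotNr. Qed.

Lemma dot0r x : dotr x 0 = 0.
Proof. by rewrite dotC dot0l. Qed.

Lemma dot_suml (I : Type) (r : seq I) (P : pred I) (F : I -> 'rV[K]_d) x :
  dotr (\sum_(i <- r | P i) F i) x = \sum_(i <- r | P i) dotr (F i) x.
Proof. by apply: (big_morph (dotr ^~ x)) => [u v|]; rewrite ?dotDl ?dot0l. Qed.

Lemma dot_sumr (I : Type) (r : seq I) (P : pred I) (F : I -> 'rV[K]_d) x :
  dotr x (\sum_(i <- r | P i) F i) = \sum_(i <- r | P i) dotr x (F i).
Proof. by rewrite dotC dot_suml; apply: eq_bigr => i _; rewrite dotC. Qed.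

Lemma dot_ge0 x : 0 <= dotr x x.
Proof. by apply: sumr_ge0 => i _; rewrite -expr2 sqr_ge0. Qed.

Lemma dot_eq0 x : dotr x x = 0 -> x = 0.
Proof.
move=> /eqP; rewrite psumr_eq0; last by move=> i _; rewrite -expr2 sqr_ge0.
move=> /allP h; apply/rowP => i; rewrite mxE; apply/eqP.
by have := h i (mem_index_enum i); rewrite mulf_eq0 orbb.
Qed.

Lemma enorm_sqr x : enorm x ^+ 2 = dotr x x.
Proof.
rewrite /enorm sqr_sqrtr; last by apply: sumr_ge0 => i _; exact: sqr_ge0.
by apply: eq_bigr => i _; rewrite expr2.
Qed.

Lemma enorm_ge0 x : 0 <= enorm x.
Proof. exact: sqrtr_ge0. Qed.

Lemma enorm_le x a : 0 <= a -> (enorm x <= a) = (dotr x x <= a ^+ 2).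
Proof. by move=> a0; rewrite -enorm_sqr ler_sqr ?nnegrE ?enorm_ge0. Qed.

Lemma dot_sqr_le x y : dotr x y ^+ 2 <= dotr x x * dotr y y.
Proof.
have [y0|y0] := eqVneq (dotr y y) 0.
  by rewrite (dot_eq0 y0) !dot0r mulr0 expr0n.
have yp : 0 < dotr y y by rewrite lt_neqAle eq_sym y0 dot_ge0.
have := dot_ge0 (dotr y y *: x - dotr x y *: y).
rewrite !(dotBl, dotBr, dotZl, dotZr) (dotC y x) => h.
rewrite -subr_ge0 -(pmulr_rge0 _ yp).
by apply: le_trans h _; rewrite le_eqVlt; apply/orP; left; apply/eqP; ring.
Qed.

Lemma dot_le_enorm x y : dotr x y <= enorm x * enorm y.
Proof.
have [h|h] := leP (dotr x y) 0; first by rewrite (le_trans h)// mulr_ge0 ?enorm_ge0.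
rewrite -ler_sqr ?nnegrE ?mulr_ge0 ?enorm_ge0 ?(ltW h)//.
by rewrite exprMn !enorm_sqr dot_sqr_le.
Qed.

End Dot.

Definition dotE := (@dotDl, @dotDr, @dotNl, @dotNr, @dotZl, @dotZr, @dot0l, @dot0r).

Section Gradient.
Context {K : realType} {d : nat}.
Implicit Types (f : 'rV[K]_d -> K) (x y v : 'rV[K]_d).

Lemma diff_dot f x v : differentiable f x -> 'd f x v = dotr (grad f x) v.
Proof.
move=> df; rewrite [in LHS](row_sum_delta v) linear_sum; apply: eq_bigr => i _.
by rewrite linearZ /= mxE deriveE// mulrC.
Qed.

Lemma is_derive_line f x v (t : K) : (forall y, differentiable f y) ->
  is_derive t 1 (fun s => f (x + s *: v)) (dotr (grad f (x + t *: v)) v).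
Proof.
move=> df.
have e : (fun h : K => h^-1 *: ((fun s => f (x + s *: v)) (h *: 1 + t) -
      f (x + t *: v))) =
    (fun h : K => h^-1 *: (f (h *: v + (x + t *: v)) - f (x + t *: v))).
  apply/funext => h; congr (_ *: (f _ - _)).
  by rewrite -[h *: 1]/(h * 1) mulr1 scalerDl addrCA.
have dv : derivable f (x + t *: v) v by exact: diff_derivable.
split.
  by rewrite /derivable /= e.
rewrite -(diff_dot v (df _)) -deriveE//.
by rewrite /derive /= e.
Qed.

(** The mean value theorem replaces the usual integral of the gradient along the segment. The sign
    [s] handles both sides of the absolute value at once. *)
Lemma descent f (L : K) x y : (forall z, differentiable f z) ->
  lipschitz_grad L f ->
  `|f y - f x - dotr (grad f x) (y - x)| <= L / 2 * dotr (y - x) (y - x).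
Proof.
move=> df lf; set v := y - x.
have step (s : K) : s ^+ 2 = 1 ->
    s * (f y - f x - dotr (grad f x) v) <= L / 2 * dotr v v.
  move=> s1.
  (* Subtracting L/2 t^2 |v|^2 makes the derivative nonpositive, by Cauchy-Schwarz and the Lipschitz
     bound. *)
  pose p t := s * f (x + t *: v) - s * dotr (grad f x) v * t
    - L / 2 * dotr v v * t ^+ 2.
  pose p' t := s * dotr (grad f (x + t *: v)) v - s * dotr (grad f x) v
    - L * dotr v v * t.
  have dp (t : K) : is_derive t 1 p (p' t).
    have h1 := is_derive_line x v t df.
    rewrite /p; apply: is_derive_eq.
    rewrite /p' /GRing.scale /=.
    by field.
  have cp : {within `[0, 1], continuous p}.
    apply: derivable_within_continuous => t _.
    by have [] := dp t.
  have [c /[!in_itv]/= /andP[c0 c1] e] := @MVT _ p p' 0 1 ltr01 (fun t _ => dp t) cp.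
  have : p 1 - p 0 <= 0.
    rewrite e subr0 mulr1 /p' -mulrBr -dotBl subr_le0.
    have E : s * dotr (grad f (x + c *: v) - grad f x) v =
       dotr (s *: (grad f (x + c *: v) - grad f x)) v by rewrite dotZl.
    rewrite E; apply: (le_trans (dot_le_enorm _ _)).
    have -> : enorm (s *: (grad f (x + c *: v) - grad f x)) =
       enorm (grad f (x + c *: v) - grad f x).
      apply/eqP; rewrite -(eqrXn2 (n := 2))// ?enorm_ge0// !enorm_sqr dotZl dotZr.
      by rewrite mulrA -expr2 s1 mul1r.
    apply: (@le_trans _ _ (L * enorm (c *: v) * enorm v)).
      rewrite ler_wpM2r ?enorm_ge0//.
      by have := lf (x + c *: v) x; rewrite addrAC subrr add0r.
    have -> : enorm (c *: v) = c * enorm v.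
      apply/eqP; rewrite -(eqrXn2 (n := 2))// ?mulr_ge0 ?enorm_ge0 ?ltW// .
      by rewrite exprMn !enorm_sqr dotZl dotZr expr2 mulrA.
    by rewrite -enorm_sqr expr2 le_eqVlt; apply/orP; left; apply/eqP; ring.
  rewrite /p scale0r scale1r addr0 /v (addrC x) subrK !expr1n !expr0n /= => h.
  by lra.
rewrite ler_norml; apply/andP; split.
  by have := step (-1); rewrite sqrrN expr1n => /(_ erefl); lra.
by have := step 1; rewrite expr1n => /(_ erefl); lra.
Qed.

Lemma dot_continuous (g : 'rV[K]_d) : continuous (dotr g).
Proof.
apply: continuous_big => [|i _ x]; first exact: add_continuous.
by apply: continuousM; [exact: cst_continuous | exact: coord_continuous].
Qed.

Lemma dot_le_norm x : dotr x x <= d%:R * `|x| ^+ 2.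
Proof.
rewrite /dotr (@le_trans _ _ (\sum_(i < d) `|x| ^+ 2))//; last first.
  by rewrite sumr_const card_ord mulr_natl.
apply: ler_sum => i _; rewrite -expr2 -real_normK ?num_real//.
rewrite ler_sqr ?nnegrE// [leRHS]/Num.norm /= mx_normrE.
by apply/bigmax_geP; right; exists (ord0, i).
Qed.

End Gradient.

Lemma little_differentiable (K : realType) (V W : normedModType K) (f : V -> W)
  (df : {linear V -> W}) (x : V) : continuous df ->
  (forall e : K, 0 < e ->
    \forall h \near (0 : V), `|f (h + x) - f x - df h| <= e * `|h|) ->
  differentiable f x /\ 'd f x = df :> (V -> W).
Proof.
move=> cf lo.
have ex : f \o shift x = cst (f x) + df +o_ 0 id.
  apply/eqaddoP => e e0; near=> v.
  rewrite !fctE /= opprD addrA; near: v; exact: lo.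
have eg := diff_unique cf ex.
by split=> //; apply/diff_locallyP; rewrite eg.
Unshelve. all: by end_near. Qed.

Section GradientConverse.
Context {K : realType} {d : nat}.
Implicit Types (f : 'rV[K]_d -> K) (x y v : 'rV[K]_d).

(** Serves the worst-case function: its gradient is read off from two-sided quadratic bounds, with
    no formula for the envelope. *)
Lemma quadratic_differentiable f x (g : 'rV[K]_d) (C : K) :
  (forall y, `|f y - f x - dotr g (y - x)| <= C * dotr (y - x) (y - x)) ->
  differentiable f x /\ grad f x = g.
Proof.
move=> fC.
have lin : linear (dotr g : 'rV[K]_d -> K).
  by move=> a u v; rewrite dotDr dotZr.
pose linM := GRing.isLinear.Build _ _ _ _ _ lin.
pose gL : {linear 'rV[K]_d -> K} := HB.pack (dotr g : 'rV[K]_d -> K) linM.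
have cg : continuous gL by exact: dot_continuous.
have [|df eg] := @little_differentiable K _ _ f gL x cg.
  move=> e e0.
  have C1 : 0 < `|C| * d%:R + 1 by rewrite ltr_wpDl ?mulr_ge0.
  near=> v.
  have := fC (v + x); rewrite addrK => h.
  apply: (le_trans h); apply: (@le_trans _ _ (`|C| * (d%:R * `|v| ^+ 2))).
    apply: (@le_trans _ _ (`|C| * dotr v v)).
      by rewrite ler_wpM2r ?dot_ge0 ?ler_norm.
    by rewrite ler_wpM2l ?dot_le_norm.
  rewrite expr2 !mulrA ler_wpM2r//.
  have vs : `|v| <= e / (`|C| * d%:R + 1).
    by near: v; apply: (@nbhs0_le K 'rV[K]_d); rewrite divr_gt0.
  apply: (@le_trans _ _ ((`|C| * d%:R + 1) * `|v|)).
    by rewrite ler_wpM2r// lerDl.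
  by rewrite mulrC -ler_pdivlMr.
split=> //; apply/rowP => i; rewrite mxE deriveE// eg /=.
rewrite /dotr (bigD1 i)//= big1 => [|j ji]; rewrite mxE ?eqxx ?(negPf ji) /=.
  by rewrite mulr1 addr0.
by rewrite mulr0.
Unshelve. all: by end_near. Qed.

End GradientConverse.

(** * Interpolation inequalities of smooth strongly convex functions *)

Section Interpolation.
Context {K : realType} {d : nat}.
Implicit Types (x y : 'rV[K]_d).

(* The characteristic inequality of q-strongly convex functions with 1-Lipschitz
   gradient, for a function F with gradient G, multiplied by 2(1 - q). *)
Definition interpolable (q : K) (F : 'rV[K]_d -> K)
    (G : 'rV[K]_d -> 'rV[K]_d) : Prop :=
  forall x y, dotr (G x - G y) (G x - G y) + q * dotr (x - y) (x - y)
    - 2 * q * dotr (G x - G y) (x - y)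
    <= 2 * (1 - q) * (F x - F y - dotr (G y) (x - y)).

(** Stands for letting t tend to 0 when a first-order condition is extracted along a segment: t = a
    / (2 b) would give a <= a / 2. *)
Lemma le_mul_small (a b : K) : (forall t, 0 < t <= 1 -> a <= b * t) -> a <= 0.
Proof.
move=> h; rewrite leNgt; apply/negP => a0.
have b0 : 0 < b by have := h 1; rewrite ltr01 lexx mulr1 => /(_ isT); lra.
have t0 : 0 < a / (2 * b) by rewrite divr_gt0 ?mulr_gt0.
have [t1|t1] := leP (a / (2 * b)) 1.
  have := h _ (introT andP (conj t0 t1)).
  have -> : b * (a / (2 * b)) = a / 2 by field; rewrite gt_eqF.
  by lra.
have := h 1; rewrite ltr01 lexx mulr1 => /(_ isT) => ab.
by move: t1; rewrite ltr_pdivlMr ?mulr_gt0//; lra.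
Qed.

(** Strong convexity at the point x + t (y - x) and the lower half of [descent] there differ from
    the claim, times t, by (mu + L) / 2 t^2 |y - x|^2; divide by t and let t vanish. *)
Lemma strongly_convex_tangent (mu L : K) (f : 'rV[K]_d -> K) x y :
  smooth_strongly_convex mu L f ->
  f x + dotr (grad f x) (y - x) + mu / 2 * dotr (y - x) (y - x) <= f y.
Proof.
move=> [df sf lf]; set D := dotr (y - x) (y - x).
suff : f x + dotr (grad f x) (y - x) + mu / 2 * D - f y <= 0 by lra.
apply: (@le_mul_small _ ((mu + L) / 2 * D)) => t /andP[t0 t1].
have tt : 0 <= t <= 1 by rewrite ltW.
have h1 := sf y x t tt.
have e : t *: y + (1 - t) *: x = x + t *: (y - x).
  by rewrite scalerBl scale1r scalerBr addrCA.
have e2 : x + t *: (y - x) - x = t *: (y - x) by rewrite addrAC subrr add0r.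
have := descent x (x + t *: (y - x)) df lf.
rewrite e2 dotZr !dotZl dotZr -/D.
rewrite -/D; move: h1; rewrite e enorm_sqr -/D => h1 /ler_normlP[h2 _].
rewrite -(ler_pM2l t0).
set A := f (x + _) in h1 h2.
set B := dotr (grad f x) _ in h2 *.
by lra.
Qed.

Lemma smooth_interpolable (mu L : K) (f : 'rV[K]_d -> K) :
  0 < L -> 0 <= mu < L -> smooth_strongly_convex mu L f ->
  interpolable (mu / L) (fun x => L^-1 * f x) (fun x => L^-1 *: grad f x).
Proof.
move=> L0 /andP[mu0 muL] sf x y.
have [df _ lf] := sf.
set q := mu / L; have q0 : 0 <= q by rewrite divr_ge0 // ltW.
have q1 : 0 < 1 - q by rewrite subr_gt0 ltr_pdivrMr// mul1r.
have Li : 0 < L^-1 by rewrite invr_gt0.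
have muE : mu = q * L by rewrite /q divfK ?gt_eqF.
pose F z := L^-1 * f z; pose G z := L^-1 *: grad f z.
have tan u v : F u + dotr (G u) (v - u) + q / 2 * dotr (v - u) (v - u) <= F v.
  have := strongly_convex_tangent u v sf.
  rewrite -(ler_pM2l Li) /F /G dotZl; apply: le_trans.
  rewrite le_eqVlt; apply/orP; left; apply/eqP.
  by rewrite muE; field; rewrite gt_eqF.
have des u v : F v <= F u + dotr (G u) (v - u) + 2^-1 * dotr (v - u) (v - u).
  have /ler_normlP[_] := descent u v df lf.
  rewrite -(ler_pM2l Li) /F /G dotZl => h.
  have -> : L^-1 * f v =
    L^-1 * (f v - f u - dotr (grad f u) (v - u)) +
      L^-1 * f u + L^-1 * dotr (grad f u) (v - u) by ring.
  have e : L^-1 * (L / 2 * dotr (v - u) (v - u)) = 2^-1 * dotr (v - u) (v - u).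
    by field; rewrite gt_eqF.
  by move: h; rewrite e; lra.
(* Compare both sides at the gradient step from x for the function
   F - q/2 |.|^2 tilted by its gradient at y, whose minimiser is y. *)
pose h := (1 - q)^-1 *: (G x - G y - q *: (x - y)).
have h1 := tan y (x - h); have h2 := des x (x - h).
have := le_trans h1 h2.
rewrite -/(F x) -/(F y) -/(G x) -/(G y).
have E : G x - G y = q *: (x - y) + (1 - q) *: h.
  by rewrite /h scalerA mulfV ?gt_eqF// scale1r [RHS]addrC subrK.
have e3 : x - h - x = - h by rewrite addrAC subrr add0r.
have e4 : x - h - y = (x - y) - h by rewrite addrAC.
have e5 : G x = G y + (q *: (x - y) + (1 - q) *: h) by rewrite -E [RHS]addrC subrK.
rewrite e3 e4 E e5; set w := x - y; set g := G y.
clearbody h w g.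
rewrite !(dotDl, dotDr) !(dotNl, dotNr, dotZl, dotZr) (dotC h w).
set ww := dotr w w; set wh := dotr w h; set hh := dotr h h.
set gw := dotr g w; set gh := dotr g h => h0.
rewrite -subr_ge0 in h0.
have := mulr_ge0 (ltW q1) h0.
by lra.
Qed.

Lemma grad_argmin (mu L : K) (f : 'rV[K]_d -> K) x : 0 < L ->
  smooth_strongly_convex mu L f -> argmin f x -> grad f x = 0.
Proof.
move=> L0 [df _ lf] fx; apply: dot_eq0; apply/eqP; rewrite eq_le dot_ge0 andbT.
set g := grad f x.
have e2 : x - L^-1 *: g - x = - (L^-1 *: g) by rewrite addrAC subrr add0r.
have /ler_normlP[_] := descent x (x - L^-1 *: g) df lf.
rewrite e2 !dotE -/g => h.
have := fx (x - L^-1 *: g) => h2.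
have e : L / 2 * (L^-1 * (L^-1 * dotr g g)) = L^-1 * dotr g g / 2.
  by field; rewrite gt_eqF.
rewrite -(@ler_pM2l _ (L^-1)) ?invr_gt0// mulr0.
by lra.
Qed.

Lemma fmin_argmin (f : 'rV[K]_d -> K) x : argmin f x -> fmin f = f x.
Proof.
move=> fx; apply/eqP; rewrite eq_le; apply/andP; split.
  apply: ge_inf; last by exists x.
  by exists (f x) => _ [z _ <-].
apply: lb_le_inf; first by exists (f x), x.
by move=> _ [z _ <-].
Qed.

End Interpolation.

(** * The paired backward sequence *)

Lemma down_ind (N : nat) (P : nat -> Prop) : P N ->
  (forall k, (k < N)%N -> P k.+1 -> P k) -> forall k, (k <= N)%N -> P k.
Proof.
move=> PN S k kN; rewrite -(subKn kN); move: (leq_subr k N).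
elim: (N - k)%N => [|j IH] jN; first by rewrite subn0.
apply: S; first by rewrite ltn_subrL (leq_trans _ jN).
by rewrite subnSK//; apply: IH; exact: ltnW.
Qed.

Section Backward.
Context {K : realType}.
Variables (N : nat) (q r : K).
Hypotheses (q0 : 0 <= q) (q1 : q < 1).
Local Notation a := (pa N q r).
Local Notation b := (pb N q r).
Definition pc k : K := Num.sqrt (radicand q (pa N q r k)).
Local Notation c := pc.

Lemma pa_last : a N = r.
Proof. by rewrite /pa /paired subnn. Qed.

Lemma pb_last : b N = Num.sqrt (1 - q) * r.
Proof. by rewrite /pb /paired subnn. Qed.

Lemma paired_step k : (k < N)%N ->
  a k = ((1 - q) + q * a k.+1) * a k.+1 + c k.+1 * b k.+1 /\
  b k = - q * c k.+1 * a k.+1 + ((1 - q) + q * a k.+1) * b k.+1.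
Proof.
move=> kN.
have e : paired N q r k = backward_step q (paired N q r k.+1).
  by rewrite /paired -(subnSK kN) iterS.
by rewrite /pc /pa /pb e; case: (paired _ _ _ _) => x y.
Qed.

Lemma pc_sqr k : 0 <= radicand q (a k) ->
  c k ^+ 2 = 2 * (1 - a k) - q * (1 - a k) ^+ 2.
Proof. by move=> h; rewrite /pc sqr_sqrtr// /radicand; ring. Qed.

Lemma pc_ge0 k : 0 <= c k.
Proof. exact: sqrtr_ge0. Qed.

Lemma radicand_ge0 k : 0 <= a k <= 1 -> 0 <= radicand q (a k).
Proof.
move=> /andP[h0 h1]; rewrite /radicand mulr_ge0 ?subr_ge0//.
by have := mulr_ge0 q0 h0; have := q1; lra.
Qed.

Lemma radicand_gt0 k : 0 <= a k < 1 -> 0 < radicand q (a k).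
Proof.
move=> /andP[h0 h1]; rewrite /radicand mulr_gt0 ?subr_gt0//.
by have := mulr_ge0 q0 h0; have := q1; lra.
Qed.

(* The backward step rotates (sqrt q a, b). *)
Lemma pb_sqr k : (forall j, (k < j <= N)%N -> 0 <= radicand q (a j)) ->
  (k <= N)%N -> b k ^+ 2 = r ^+ 2 - q * a k ^+ 2.
Proof.
move=> h kN; move: k kN h.
apply: down_ind => [_|k kN IH h].
  by rewrite pb_last pa_last exprMn sqr_sqrtr ?subr_ge0 ?ltW//; ring.
have /IH {}IH j : (k.+1 < j <= N)%N -> 0 <= radicand q (a j).
  by move=> /andP[h1 h2]; apply: h; rewrite h2 ltnW.
have c2 : c k.+1 ^+ 2 = 2 * (1 - a k.+1) - q * (1 - a k.+1) ^+ 2.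
  by apply: pc_sqr; apply: h; rewrite ltnSn.
have [-> ->] := paired_step kN.
move: IH c2; move: (a _) (b _) (c _) => x y z IH c2.
have -> : r ^+ 2 = y ^+ 2 + q * x ^+ 2 by rewrite IH; ring.
have e : (1 - q + q * x) ^+ 2 + q * z ^+ 2 = 1 by rewrite c2; ring.
apply/eqP; rewrite eq_sym subr_eq; apply/eqP.
rewrite -[LHS]mul1r -{1}e; ring.
Qed.

Hypotheses (N1 : (1 <= N)%N) (ord : ordered N q r).

Lemma pa_le k j : (1 <= k)%N -> (k <= j <= N)%N -> a j <= a k.
Proof.
move=> k1 /andP[kj]; rewrite -(subnKC kj); elim: (j - k)%N => [|i IH] h.
  by rewrite addn0.
have [_ _ inc _ _] := ord.
rewrite addnS in h *; apply: le_trans (IH (ltnW h)).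
by apply/ltW/inc; rewrite h andbT (leq_trans k1)// leq_addr.
Qed.

Lemma pa_gt0 k : (1 <= k <= N)%N -> 0 < a k.
Proof.
move=> /andP[k1 kN]; have [_ _ _ aN _] := ord.
by apply: lt_le_trans aN _; apply: pa_le => //; rewrite kN leqnn.
Qed.

Lemma pa_lt1 k : (1 <= k <= N)%N -> a k < 1.
Proof.
move=> /andP[k1 kN]; have [_ a1 _ _ _] := ord.
by apply: le_lt_trans a1; apply: pa_le => //; rewrite k1.
Qed.

Lemma pc_gt0 k : (1 <= k <= N)%N -> 0 < c k.
Proof.
by move=> h; rewrite sqrtr_gt0 radicand_gt0// (pa_lt1 h) (ltW (pa_gt0 h)).
Qed.

Lemma pcE k : (1 <= k <= N)%N -> c k ^+ 2 = 2 * (1 - a k) - q * (1 - a k) ^+ 2.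
Proof.
by move=> h; apply/pc_sqr/radicand_ge0; rewrite (ltW (pa_gt0 h)) (ltW (pa_lt1 h)).
Qed.

Lemma pbE k : (1 <= k <= N)%N -> b k ^+ 2 = r ^+ 2 - q * a k ^+ 2.
Proof.
move=> /andP[k1 kN]; apply: pb_sqr => // j /andP[kj jN].
have h : (1 <= j <= N)%N by rewrite jN (leq_trans k1)// ltnW.
by apply/radicand_ge0; rewrite (ltW (pa_gt0 h)) (ltW (pa_lt1 h)).
Qed.

(** Only b_1 > 0 is part of [ordered]. If b_{k+1} were nonpositive, both terms of the step producing
    b_k would be too, so positivity climbs from 1 to N. *)
Lemma pb_gt0 k : (1 <= k <= N)%N -> 0 < b k.
Proof.
case: k => // k; elim: k => [_|k IH /= kN]; first by have [] := ord.
have := IH (ltnW kN); have [_ ->] := paired_step kN.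
rewrite !ltNge => /negP h; apply/negP => b0; apply: h.
have a0 : 0 < a k.+2 by rewrite pa_gt0.
have c0 : 0 < c k.+2 by rewrite pc_gt0.
have d0 : 0 <= 1 - q + q * a k.+2
  by rewrite addr_ge0 ?subr_ge0 ?(ltW q1)// mulr_ge0// ltW.
have := mulr_ge0 (mulr_ge0 q0 (ltW c0)) (ltW a0).
have := mulr_ge0_le0 d0 b0.
by lra.
Qed.

(** If c_{k+1} <= b_{k+1}, the step would give a_k >= 1 + (1 - q)(1 - a_{k+1}) > 1. *)
Lemma pb_lt_pc k : (1 <= k < N)%N -> b k.+1 < c k.+1.
Proof.
move=> /andP[k1 kN]; rewrite ltNge; apply/negP => cb.
have h : (1 <= k.+1 <= N)%N by [].
have := pa_lt1 (k := k); rewrite k1 (ltnW kN) => /(_ isT).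
have [-> _] := paired_step kN.
have := ler_wpM2l (pc_ge0 k.+1) cb; rewrite -expr2 pcE//.
have := mulr_gt0 (_ : 0 < 1 - q) (_ : 0 < 1 - a k.+1).
rewrite !subr_gt0 q1 pa_lt1// => /(_ isT isT).
by lra.
Qed.

End Backward.

(** * Consequences of the risk equation *)

Section RiskCoefficient.
Context {K : realType}.
Variables (N : nat) (q wx wf wg eta : K).
Hypotheses (q0 : 0 <= q) (q1 : q < 1) (N1 : (1 <= N)%N).
Hypotheses (hwx : 0 <= wx) (hwf : 0 <= wf) (hw : wx + wf + wg = 1).
Hypothesis rc : risk_coefficient N q wx wf eta.
Local Notation r := (rcoef q wx wf eta).
Local Notation a := (pa N q r).
Local Notation b := (pb N q r).
Local Notation c := (item_c N q wx wf eta).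
Local Notation y := (Num.sqrt ((1 - q) * eta)).

Lemma rc_ordered : ordered N q r.
Proof. by have [_ _ []] := rc. Qed.

Lemma rc_r_gt0 : 0 < r.
Proof. by have [_ _ [/andP[]]] := rc. Qed.

Lemma rc_r_lt1 : r < 1.
Proof. by have [_ _ [/andP[]]] := rc. Qed.

Lemma rc_sqr : r ^+ 2 = q + eta * ((1 - q) * wx - q * wf).
Proof. by have [_ h _ _] := rc; rewrite sqr_sqrtr// ltW. Qed.

Lemma rc_eta_gt0 : 0 < eta.
Proof.
have [e0 _ _ e] := rc; rewrite lt_neqAle e0 andbT; apply/eqP => z.
move: e; rewrite -z mul0r mul0r sqrtr0 mul0r !addr0 => e.
by have [_ + _ _ _] := rc_ordered; rewrite -z e ltxx.
Qed.

Lemma rc_y_gt0 : 0 < y.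
Proof. by rewrite sqrtr_gt0 mulr_gt0 ?subr_gt0// rc_eta_gt0. Qed.

Lemma rc_ysqr : y ^+ 2 = (1 - q) * eta.
Proof. by rewrite sqr_sqrtr// mulr_ge0 ?subr_ge0 ?(ltW q1) ?(ltW rc_eta_gt0). Qed.

(** The risk equation times 1 - q; in the variable y both eta and sqrt(eta / (1 - q)) become
    polynomial. *)
Lemma rc_eq : (1 - q) * (1 - a 1%N) = (wx + wf) * y ^+ 2 + y * b 1%N.
Proof.
have [_ _ _ e] := rc.
have qb : 0 < 1 - q by rewrite subr_gt0.
have ye : Num.sqrt (eta / (1 - q)) * (1 - q) = y.
  rewrite -{2}(ger0_norm (ltW qb)) -sqrtr_sqr -sqrtrM; last first.
    by rewrite divr_ge0 ?(ltW rc_eta_gt0) ?(ltW qb).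
  by congr Num.sqrt; field; rewrite gt_eqF.
move/(congr1 (fun t => (1 - q) * t)): e; rewrite mulr1 rc_ysqr => e.
by rewrite -{1}ye; lra.
Qed.

Lemma rc_a1 : 0 < a 1%N < 1.
Proof.
by rewrite (pa_gt0 rc_ordered) ?(pa_lt1 rc_ordered) ?N1.
Qed.

Lemma rc_b1 : 0 < b 1%N.
Proof. by have [_ _ _ _] := rc_ordered. Qed.

Lemma rc_b1_sqr :
  b 1%N ^+ 2 = q + eta * ((1 - q) * wx - q * wf) - q * a 1%N ^+ 2.
Proof. by rewrite (pbE q0 q1 rc_ordered) ?N1// rc_sqr. Qed.

Lemma item_c1 : c 1%N = b 1%N + y. Proof. by []. Qed.

Lemma item_cE k : (1 < k)%N -> c k = pc N q r k.
Proof. by case: k => [|[]]. Qed.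

(** The counterpart at index 1 of c^2 = 2 (1 - a) - q (1 - a)^2. Together with [b1_c1] it is the
    form in which the risk equation cancels the quadratic terms of the first step in both bounds. *)
Lemma c1_sqr : c 1%N ^+ 2 = 2 * (1 - a 1%N) - q * (1 - a 1%N) ^+ 2
  - eta * wf + eta * (1 - q) * wg.
Proof.
have -> : wg = 1 - wx - wf by rewrite -hw; ring.
rewrite item_c1 sqrrD rc_b1_sqr rc_ysqr; move: rc_eq; rewrite rc_ysqr.
by lra.
Qed.

(** Equivalently, a backward step with c_1 in place of its own c would give a_0 = 1 - eta w_f. *)
Lemma b1_c1 : b 1%N * c 1%N =
  (1 - a 1%N) + q * (1 - a 1%N) * a 1%N - eta * wf.
Proof.
rewrite item_c1 mulrDr -expr2 rc_b1_sqr; move: rc_eq; rewrite rc_ysqr.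
by lra.
Qed.

(* The value b_0 that a backward step with c_1 in place of its own c would give. *)
Definition pb0 : K := (1 - q) * b 1%N - q * a 1%N * y.

(** Eliminating w_f between [rc_eq] and [rc_b1_sqr] gives b_1 b_0 = q (1 - q) a_1 (1 - a_1) + w_x
    y^2 + q y b_1 (1 - a_1), where b_0 is [pb0]; for q = 0, b_0 is just b_1. *)
Lemma pb0_gt0 : 0 < pb0.
Proof.
rewrite ltNge; apply/negP; rewrite /pb0.
have := rc_a1; have := rc_b1; have := rc_y_gt0; have := rc_eq; have := rc_b1_sqr.
move/(congr1 (fun t => (1 - q) * t)); have := rc_ysqr.
move: (a _) (b _) y => u v z e1 e2 e3 z0 v0 /andP[u0 u1] h.
have qb : 0 < 1 - q by rewrite subr_gt0.
have [qe|qn] := eqVneq q 0; first by move: h; rewrite qe; lra.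
have qp : 0 < q by rewrite lt_neqAle eq_sym qn.
have h1 : 0 <= v * (q * u * z - (1 - q) * v) by rewrite mulr_ge0 ?(ltW v0)//; lra.
have h2 : 0 < q * (1 - q) * (1 - u) * u by rewrite !mulr_gt0// subr_gt0.
have h3 : 0 <= q * z * v * (1 - u).
  by rewrite !mulr_ge0 ?(ltW v0) ?(ltW z0)// subr_ge0 ltW.
have h4 : 0 <= wx * z ^+ 2 by rewrite mulr_ge0 ?sqr_ge0.
move/(congr1 (fun t => q * t)): e3 => e3.
have e4 : eta * (1 - q) * wx = wx * z ^+ 2 by rewrite e1; ring.
have e5 : eta * (1 - q) * wf = wf * z ^+ 2 by rewrite e1; ring.
move/(congr1 (fun t => q * t)): (e5) => e6.
move/(congr1 (fun t => q * t)): (e4) => e7.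
by lra.
Qed.

(** This is [chain_A_rec] at k = 0 in disguise: it fixes the constant w_x y^2 / b_0 in [opt_A]. *)
Lemma rc_slack :
  ((1 - q) * b 1%N - q * y) * r ^+ 2 - q * a 1%N * pb0
    = b 1%N * wx * y ^+ 2.
Proof.
have e : r ^+ 2 = b 1%N ^+ 2 + q * a 1%N ^+ 2.
  by rewrite (pbE q0 q1 rc_ordered) ?N1//; ring.
have -> : ((1 - q) * b 1%N - q * y) * r ^+ 2 - q * a 1%N * pb0
    = b 1%N * ((1 - q) * r ^+ 2 - q * (y * b 1%N + (1 - q) * a 1%N)).
  by rewrite /pb0 e; ring.
rewrite rc_sqr; have := rc_eq => e2.
have -> : y * b 1%N + (1 - q) * a 1%N = 1 - q - (wx + wf) * y ^+ 2 by lra.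
by rewrite rc_ysqr; ring.
Qed.

End RiskCoefficient.

(* Scalar data of the worst-case function: x_* has coordinates -xi_l, and the
   k-th affine piece has slope gamma_k u_k + q sum_(l < k) tau_l u_l. The A_k are
   the tail masses of the convex combination that dominates the piece of x_*. *)
Record chain (K : realType) (N : nat) (q : K) (gam xi tau A : nat -> K) : Prop :=
  Chain {
  chain_gam : forall k, (k <= N)%N -> 0 < gam k < xi k;
  chain_tau : forall k, (k < N)%N -> tau k <= xi k;
  chain_pos : forall k, (k < N)%N -> 0 < gam k - q * tau k;
  chain_prod : forall k, (k < N)%N ->
    gam k.+1 * xi k.+1 = (gam k - q * tau k) * (xi k - gam k);
  chain_A0 : A 0%N = 1;
  chain_A_ge0 : forall k, (k <= N)%N -> 0 <= A k;
  chain_A_rec : forall k, (k < N)%N ->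
    A k.+1 * (gam k - q * tau k) = A k * gam k - q * xi k;
  chain_A_last : q * xi N <= A N * gam N }.

(** * The optimal chain attached to a risk coefficient *)

Section ChainOfCoefficient.
Context {K : realType}.
Variables (N : nat) (q wx wf wg eta s0 : K).
Hypotheses (q0 : 0 <= q) (q1 : q < 1) (N1 : (1 <= N)%N).
Hypotheses (hwx : 0 <= wx) (hwf : 0 <= wf) (hw : wx + wf + wg = 1).
Hypothesis rc : risk_coefficient N q wx wf eta.
Hypothesis s00 : 0 < s0.
Local Notation r := (rcoef q wx wf eta).
Local Notation a := (pa N q r).
Local Notation b := (pb N q r).
Local Notation c := (item_c N q wx wf eta).
Local Notation y := (Num.sqrt ((1 - q) * eta)).
Local Notation b0 := (pb0 N q wx wf eta).

(** Index k of the chain uses the pair k + 1 of the backward sequence. At k = N the last stage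
    maximises 2 gamma xi - gamma^2 - r^2 xi^2 for a given product gamma xi; the optimum gamma = r xi
    gives the values r and 1. *)
Definition chain_b k := if (k < N)%N then b k.+1 else r.
Definition chain_c k := if (k < N)%N then c k.+1 else 1.
Definition chain_pb k := if k == 0%N then b0 else b k.
(** The backward sequence gives the ratio gamma_k : xi_k; the square root is the change of scale
    that [chain_prod] then forces. *)
Fixpoint chain_scale k := if k is j.+1 then
    chain_scale j * Num.sqrt (chain_pb j * (chain_c j - chain_b j)
      / (chain_b j.+1 * chain_c j.+1))
  else s0.
Definition opt_gam k := chain_b k * chain_scale k.
Definition opt_xi k := chain_c k * chain_scale k.
(** The maximiser in tau of 2 (1 - a_{k+1}) (gamma_k - q tau) (xi_k - gamma_k) - q (xi_k -
    tau)^2. *)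
Definition opt_tau k := a k.+1 * opt_xi k + (1 - a k.+1) * opt_gam k.
(* Closed form of the recursion [chain_A_rec]: along the backward sequence
   A_k / b_k - (q / r^2) (a_k / b_k) is constant. *)
Definition opt_A k := if k == 0%N then 1
  else (q * a k + wx * y ^+ 2 / b0 * b k) / r ^+ 2.

Let ord := rc_ordered rc.
Let rgt0 := rc_r_gt0 rc.
Let b00 : 0 < b0 := pb0_gt0 q0 q1 N1 hwx rc.

Lemma chain_b_lt_c k : (k <= N)%N -> 0 < chain_b k < chain_c k.
Proof.
rewrite /chain_b /chain_c; case: ifP => [kN _|_ _]; last by rewrite rgt0 (rc_r_lt1 rc).
rewrite (pb_gt0 q0 q1 ord) ?kN//=; case: k kN => [|k] kN.
  by rewrite item_c1 ltrDl (rc_y_gt0 q1 rc).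
by rewrite item_cE// (pb_lt_pc q0 q1 ord).
Qed.

Lemma chain_pb_gt0 k : (k <= N)%N -> 0 < chain_pb k.
Proof.
by rewrite /chain_pb; case: eqVneq => // + kN; rewrite -lt0n => k0;
  rewrite (pb_gt0 q0 q1 ord)// k0.
Qed.

Lemma chain_scale_gt0 k : (k <= N)%N -> 0 < chain_scale k.
Proof.
elim: k => [//|k IH kN] /=; rewrite mulr_gt0 ?IH 1?ltnW// sqrtr_gt0.
have /andP[h1 h2] := chain_b_lt_c (ltnW kN); have /andP[h3 h4] := chain_b_lt_c kN.
by rewrite divr_gt0 ?mulr_gt0 ?subr_gt0 ?chain_pb_gt0 ?(lt_trans h3 h4)// ltnW.
Qed.

Lemma chain_pb_step k : (k < N)%N ->
  (1 - q * (1 - a k.+1)) * b k.+1 - q * a k.+1 * c k.+1 = chain_pb k.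
Proof.
case: k => [|k] kN; rewrite /chain_pb /=; first by rewrite item_c1 /pb0; ring.
by have [_ ->] := paired_step q r kN; rewrite item_cE//; ring.
Qed.

Lemma opt_gam_tau k : (k < N)%N ->
  opt_gam k - q * opt_tau k = chain_pb k * chain_scale k.
Proof.
move=> kN; rewrite -chain_pb_step// /opt_tau /opt_gam /opt_xi /chain_b /chain_c kN; ring.
Qed.

Lemma opt_prod k : (k < N)%N ->
  opt_gam k.+1 * opt_xi k.+1 = (opt_gam k - q * opt_tau k) * (opt_xi k - opt_gam k).
Proof.
move=> kN; rewrite opt_gam_tau// /opt_gam /opt_xi [chain_scale k.+1]/=.
have /andP[h1 h2] := chain_b_lt_c (ltnW kN); have /andP[h3 h4] := chain_b_lt_c kN.
have h5 := lt_trans h3 h4; have h6 := chain_pb_gt0 (ltnW kN).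
set t := Num.sqrt _.
have e : t ^+ 2 * (chain_b k.+1 * chain_c k.+1) = chain_pb k * (chain_c k - chain_b k).
  rewrite /t sqr_sqrtr; first by rewrite divfK// gt_eqF// mulr_gt0.
  by rewrite divr_ge0 ?mulr_ge0 ?subr_ge0 ?(ltW h5) ?(ltW h2) ?(ltW h3)
    ?(ltW h6).
have -> : chain_b k.+1 * (chain_scale k * t) * (chain_c k.+1 * (chain_scale k * t)) =
  chain_scale k ^+ 2 * (t ^+ 2 * (chain_b k.+1 * chain_c k.+1)) by ring.
by rewrite e; ring.
Qed.

Lemma coefficient_chain : chain N q opt_gam opt_xi opt_tau opt_A.
Proof.
have A0 k : (k <= N)%N -> 0 <= opt_A k.
  rewrite /opt_A; case: eqVneq => [//|]; rewrite -lt0n => k0 kN.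
  have h : (1 <= k <= N)%N by rewrite k0.
  rewrite divr_ge0 ?sqr_ge0// addr_ge0// mulr_ge0 ?(ltW (pa_gt0 ord h))//
    ?(ltW (pb_gt0 q0 q1 ord h))//.
  by rewrite divr_ge0 ?(ltW b00)// mulr_ge0 ?sqr_ge0.
have g0 k : (k <= N)%N -> 0 < opt_gam k < opt_xi k.
  move=> kN; have /andP[h1 h2] := chain_b_lt_c kN; have s := chain_scale_gt0 kN.
  by rewrite /opt_gam /opt_xi mulr_gt0//= ltr_pM2r.
split => // [k kN|k kN|k kN|k kN|].
- have /andP[_ h2] := g0 k (ltnW kN).
  have := pa_lt1 ord (k := k.+1); rewrite kN => /(_ isT) a1.
  have : 0 <= (1 - a k.+1) * (opt_xi k - opt_gam k).
    by rewrite mulr_ge0 ?subr_ge0 ?(ltW a1) ?(ltW h2).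
  by rewrite /opt_tau; lra.
- by rewrite opt_gam_tau// mulr_gt0 ?chain_pb_gt0 ?chain_scale_gt0// ltnW.
- exact: opt_prod.
- rewrite opt_gam_tau// /opt_gam /opt_xi /chain_b /chain_c kN.
  have r2 : r ^+ 2 != 0 by rewrite expf_neq0 ?gt_eqF.
  have bn : b0 != 0 by rewrite gt_eqF.
  case: k kN => [|k] kN.
    rewrite /opt_A /chain_pb /= item_c1 mul1r; have := rc_slack q0 q1 N1 rc.
    move: r2 bn; move: (r ^+ 2) (b0) y (a _) (b _) => R B Y u v R0 B0 e.
    have -> : v * s0 - q * ((v + Y) * s0) = ((1 - q) * v - q * Y) * s0 by ring.
    have -> : (1 - q) * v - q * Y = (q * u * B + v * wx * Y ^+ 2) / R.
      by rewrite -e; field.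
    by field; rewrite R0 B0.
  rewrite /opt_A /chain_pb /= item_cE//.
  have h : (1 <= k.+2 <= N)%N by [].
  have er := pbE q0 q1 ord h.
  have -> : r ^+ 2 = b k.+2 ^+ 2 + q * a k.+2 ^+ 2 by rewrite er; ring.
  have r3 : b k.+2 ^+ 2 + q * a k.+2 ^+ 2 != 0.
    by move: r2; have -> : r ^+ 2 = b k.+2 ^+ 2 + q * a k.+2 ^+ 2 by rewrite er; ring.
  have [-> ->] := paired_step q r kN.
  by move: r3; set u := a _; set v := b _ => r3; field; rewrite r3 bn.
- rewrite /opt_gam /opt_xi /chain_b /chain_c ltnn mul1r mulrA ler_pM2r ?chain_scale_gt0//.
  rewrite /opt_A gtn_eqF// pa_last pb_last.
  have h : 0 <= wx * y ^+ 2 / b0 * Num.sqrt (1 - q).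
    by rewrite !mulr_ge0 ?sqr_ge0 ?sqrtr_ge0// invr_ge0 ltW.
  have -> : (q * r + wx * y ^+ 2 / b0 * (Num.sqrt (1 - q) * r)) / r ^+ 2 * r
     = q + wx * y ^+ 2 / b0 * Num.sqrt (1 - q).
    by field; rewrite !gt_eqF.
  by rewrite lerDl.
Qed.

(** One stage of the dynamic program: 2 (1 - a_k) gamma_k xi_k is the optimal value of the stages
    from k on, and the subtracted terms are the cost of stage k. *)
Lemma chain_value_step k : (1 <= k < N)%N ->
  2 * (1 - a k) * (opt_gam k * opt_xi k) =
  2 * (1 - a k.+1) * (opt_gam k.+1 * opt_xi k.+1) - (r ^+ 2 - q) * opt_xi k ^+ 2
    - q * (opt_xi k - opt_tau k) ^+ 2.
Proof.
move=> /andP[k1 kN]; rewrite opt_prod// opt_gam_tau// -chain_pb_step//.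
rewrite /opt_tau /opt_gam /opt_xi /chain_b /chain_c kN item_cE//.
have h : (1 <= k.+1 <= N)%N by [].
have [-> _] := paired_step q r kN.
have er : r ^+ 2 = b k.+1 ^+ 2 + q * a k.+1 ^+ 2 by rewrite (pbE q0 q1 ord h); ring.
have := pcE q0 q1 ord h; rewrite er.
move: (a _) (b _) (pc _ _ _ _) (chain_scale k) => u v z s /eqP.
rewrite -subr_eq0 => /eqP e.
apply/eqP; rewrite -subr_eq0; apply/eqP.
transitivity (- s ^+ 2 * v ^+ 2 * (z ^+ 2 - (2 * (1 - u) - q * (1 - u) ^+ 2))).
  by ring.
by rewrite e mulr0.
Qed.

(** Stage 0. The term in gamma_0 xi_0 is 2 (1 - a_0) gamma_0 xi_0 for the formal a_0 = 1 - eta w_f;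
    the terms in gamma_0^2 are the shares of f(x_0) and of the gradient in the initial condition. *)
Lemma chain_value_0 :
  eta * (wf * (2 * (opt_gam 0 * opt_xi 0) - opt_gam 0 ^+ 2)
    + (1 - q) * wg * opt_gam 0 ^+ 2) =
  2 * (1 - a 1%N) * (opt_gam 1 * opt_xi 1) - (r ^+ 2 - q) * opt_xi 0 ^+ 2
    - q * (opt_xi 0 - opt_tau 0) ^+ 2.
Proof.
rewrite opt_prod// opt_gam_tau// -chain_pb_step//.
rewrite /opt_tau /opt_gam /opt_xi /chain_b /chain_c N1.
have h : (1 <= 1 <= N)%N by [].
have er : r ^+ 2 = b 1%N ^+ 2 + q * a 1%N ^+ 2 by rewrite (pbE q0 q1 ord h); ring.
have e1 := c1_sqr q0 q1 N1 hw rc; have e2 := b1_c1 q0 q1 N1 rc.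
rewrite er; move: e1 e2; rewrite [chain_scale 0]/=.
move: (a _) (b _) (c _) s0 => u v z s /eqP.
rewrite -subr_eq0 => /eqP e1 /eqP; rewrite -subr_eq0 => /eqP e2.
apply/eqP; rewrite -subr_eq0; apply/eqP.
transitivity (s ^+ 2 * (2 * v * z * (v * z -
  (1 - u + q * (1 - u) * u - eta * wf)) - v ^+ 2 * (z ^+ 2 - (2 * (1 - u)
  - q * (1 - u) ^+ 2 - eta * wf + eta * (1 - q) * wg)))); last first.
  by rewrite e1 e2 !mulr0 subr0 mulr0.
by ring.
Qed.

Lemma chain_value_last :
  2 * (1 - a N) * (opt_gam N * opt_xi N) =
  2 * (opt_gam N * opt_xi N) - opt_gam N ^+ 2 - r ^+ 2 * opt_xi N ^+ 2.
Proof. by rewrite pa_last /opt_gam /opt_xi /chain_b /chain_c ltnn; ring. Qed.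

(** On the left is the bound of [maxF_hidden] on 2 (1 - q) F at a point missing u_N; on the right,
    eta (1 - q) times the left-hand side of the initial condition. *)
Lemma chain_value :
  2 * (opt_gam N * opt_xi N) - opt_gam N ^+ 2 - q * opt_xi N ^+ 2
    - q * \sum_(l < N) (opt_xi l - opt_tau l) ^+ 2 =
  eta * (((1 - q) * wx - q * wf) * \sum_(l < N.+1) opt_xi l ^+ 2
    + wf * (2 * (opt_gam 0 * opt_xi 0) - opt_gam 0 ^+ 2) + (1 - q) * wg * opt_gam 0 ^+ 2).
Proof.
have tele k : (1 <= k <= N)%N -> 2 * (1 - a k) * (opt_gam k * opt_xi k) =
  eta * (wf * (2 * (opt_gam 0 * opt_xi 0) - opt_gam 0 ^+ 2) + (1 - q) * wg * opt_gam 0 ^+ 2)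
  + (r ^+ 2 - q) * \sum_(l < k) opt_xi l ^+ 2
  + q * \sum_(l < k) (opt_xi l - opt_tau l) ^+ 2.
  case: k => // k; elim: k => [_|k IH /= kN].
    by rewrite !big_ord_recr !big_ord0 /= !add0r chain_value_0; ring.
  have := chain_value_step (k := k.+1); rewrite kN => /(_ isT) e.
  have {}IH := IH (ltnW kN).
  rewrite big_ord_recr [X in _ + q * X]big_ord_recr /=.
  move: e IH; move: (\sum_(l < k.+1) _) (\sum_(l < k.+1) _) => S1 S2.
  by lra.
have := tele N; rewrite N1 leqnn => /(_ isT); rewrite chain_value_last.
rewrite big_ord_recr /= (rc_sqr rc).
lra.
Qed.

End ChainOfCoefficient.

(** * The worst-case function *)

(* The Moreau envelope of max_i (e i + <g i, .>) is treated through its dual, a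
   concave maximisation over the weights of the simplex. *)
Section MaxAffine.
Context {K : realType} {d n : nat}.
Variables (qb : K) (g : 'I_n -> 'rV[K]_d) (e : 'I_n -> K).
Implicit Types (x y : 'rV[K]_d) (al be : 'I_n -> K).

Definition comb al : 'rV[K]_d := \sum_i al i *: g i.

Definition obj x al : K :=
  \sum_i al i * e i + dotr (comb al) x - dotr (comb al) (comb al) / (2 * qb).

(** The partial derivative of [obj] in the weight i, which is also the i-th affine function
    evaluated at the proximal point of x. *)
Definition slope x al i : K := e i + dotr (g i) (x - qb^-1 *: comb al).

Definition simplex_on (P : pred 'I_n) al : Prop :=
  [/\ forall i, 0 <= al i, forall i, ~~ P i -> al i = 0 & \sum_i al i = 1].

(** No slope exceeds the weighted mean of the slopes, hence the weights sit on maximal slopes. The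
    predicate P selects a face of the simplex, so that weights can be found before the other pieces
    are known. *)
Definition kkt_on (P : pred 'I_n) x al : Prop :=
  simplex_on P al /\
  forall i, P i -> slope x al i <= \sum_j al j * slope x al j.

Lemma sum_slope x al be : \sum_i be i * slope x al i =
  \sum_i be i * e i + dotr (comb be) x - dotr (comb be) (comb al) / qb.
Proof.
rewrite /comb !dot_suml -addrA mulr_suml -sumrB -big_split; apply: eq_bigr => i _.
by rewrite /slope /= dotBr dotZr !dotZl; ring.
Qed.

Hypothesis qb0 : 0 < qb.

Lemma obj_diff x al be : obj x be = obj x al
  + (\sum_i be i * slope x al i - \sum_i al i * slope x al i)
  - dotr (comb be - comb al) (comb be - comb al) / (2 * qb).
Proof.
rewrite !sum_slope /obj !(dotBl, dotBr) (dotC (comb al) (comb be)).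
by field; rewrite gt_eqF.
Qed.

(** The quadratic gap is kept because it yields both the uniqueness of [comb] and the smoothness of
    the envelope. *)
Lemma kkt_max P x al be : kkt_on P x al -> simplex_on P be ->
  obj x be + dotr (comb be - comb al) (comb be - comb al) / (2 * qb) <= obj x al.
Proof.
move=> [_ h] [b0 bP b1]; rewrite (obj_diff x al be) subrK gerDl subr_le0.
set M := (X in _ <= X); rewrite (_ : M = \sum_i be i * M); last first.
  by rewrite -mulr_suml b1 mul1r.
apply: ler_sum => i _; have [/h Pi|/bP ->] := boolP (P i); last by rewrite !mul0r.
by rewrite ler_wpM2l.
Qed.

Lemma obj_continuous x : continuous (fun v : 'rV[K]_n => obj x (v ord0)).
Proof.
have lin (h : 'I_n -> K) : continuous (fun v : 'rV[K]_n => \sum_i v ord0 i * h i).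
  have -> : (fun v : 'rV[K]_n => \sum_i v ord0 i * h i) =
      dotr (\row_i h i) :> (_ -> _).
    by apply/funext => v; apply: eq_bigr => i _; rewrite mxE mulrC.
  exact: dot_continuous.
have comb_dot (v : 'rV[K]_n) u : dotr (comb (v ord0)) u =
    \sum_i v ord0 i * dotr (g i) u.
  by rewrite /comb dot_suml; apply: eq_bigr => i _; rewrite dotZl.
have c1 : continuous (fun v : 'rV[K]_n => dotr (comb (v ord0)) x).
  by under eq_fun do rewrite comb_dot; exact: lin.
have c2 : continuous (fun v : 'rV[K]_n => dotr (comb (v ord0)) (comb (v ord0))).
  have ck k : continuous (fun v : 'rV[K]_n => comb (v ord0) ord0 k).
    have -> : (fun v : 'rV[K]_n => comb (v ord0) ord0 k) =
        (fun v : 'rV[K]_n => \sum_i v ord0 i * g i ord0 k).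
      apply/funext => v; rewrite /comb summxE; apply: eq_bigr => i _.
      by rewrite mxE.
    exact: lin.
  apply: continuous_big => [|k _ v]; first exact: add_continuous.
  by apply: continuousM; exact: ck.
move=> v; apply: (@cvgB K K^o _ _ _ _ _ _ _
  (@cvgD K K^o _ _ _ _ _ _ _ (lin e v) (c1 v))).
exact: (@cvgM K _ _ _ _ _ _ _ (c2 v) (cvg_cst _)).
Qed.

Lemma simplex_le1 P al i : simplex_on P al -> al i <= 1.
Proof.
move=> [a0 _ <-]; rewrite (bigD1 i)//= lerDl.
by apply: sumr_ge0 => j _; exact: a0.
Qed.

Lemma simplex_compact P :
  compact [set v : 'rV[K]_n | simplex_on P (v ord0)].
Proof.
pose A i : set K := if P i then `[0, 1]%classic else [set 0].
have cA : compact [set v : 'rV[K]_n | forall i, A i (v ord0 i)].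
  apply: rV_compact => i; rewrite /A; case: (P i); first exact: segment_compact.
  exact: compact_set1.
pose B : set 'rV[K]_n := (fun v : 'rV[K]_n => \sum_i v ord0 i) @^-1` [set 1].
have cB : closed B.
  apply: closed_comp; last exact: closed_eq.
  move=> v _; apply: continuous_big => [|i _]; first exact: add_continuous.
  exact: coord_continuous.
rewrite (_ : [set v | _] = [set v : 'rV[K]_n | forall i, A i (v ord0 i)] `&` B).
  exact: compact_closedI.
apply/seteqP; split=> v /=.
  move=> sv; have [v0 vP v1] := sv; split=> // i; rewrite /A.
  case: ifPn => [_|/vP//]; rewrite /= in_itv /= v0.
  exact: simplex_le1 sv.
move=> [vA v1]; split=> // i; have := vA i; rewrite /A; case: ifPn => //= _.
- by rewrite in_itv => /andP[].
- by move=> ->.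
Qed.

Lemma kkt_exists (P : pred 'I_n) x i0 : P i0 -> exists al, kkt_on P x al.
Proof.
move=> Pi0.
have vertex i : P i -> simplex_on P (fun j => (j == i)%:R).
  move=> Pi; split=> [j|j|]; first by rewrite ler0n.
  - by case: eqVneq => // ->; rewrite Pi.
  - by rewrite (bigD1 i)//= eqxx big1 ?addr0// => j /negPf ->.
have [|c] := EVT_max_rV (A := [set v : 'rV[K]_n | simplex_on P (v ord0)])
    _ (@simplex_compact P) (continuous_subspaceT (@obj_continuous x)).
  exists (\row_j (j == i0)%:R); rewrite /=.
  have -> : (\row_j (j == i0)%:R : 'rV[K]_n) ord0 = fun j => (j == i0)%:R.
    by apply/funext => j; rewrite mxE.
  exact: vertex.
rewrite inE /= => sc cmax; exists (c ord0); split=> // i Pi.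
rewrite -subr_le0; set D := _ - _.
set Q := dotr (g i - comb (c ord0)) (g i - comb (c ord0)) / (2 * qb).
apply: (@le_mul_small _ _ Q) => t /andP[t0 t1].
(* Moving mass t from the maximiser to vertex i changes [obj] by t D - t^2 Q, which cannot be
   positive. *)
pose be j := (1 - t) * c ord0 j + t * (j == i)%:R.
have [c0 cP c1] := sc.
have vsum (h : 'I_n -> K) : \sum_j (j == i)%:R * h j = h i.
  rewrite (bigD1 i)//= eqxx mul1r big1 ?addr0// => j /negPf ->.
  by rewrite mul0r.
have sb : simplex_on P be.
  split=> [j|j /[dup] nP /cP|]; rewrite /be.
  - by rewrite addr_ge0 ?mulr_ge0 ?subr_ge0 ?ler0n ?c0 ?(ltW t0).
  - by move=> ->; case: eqVneq nP => [->|]; rewrite ?Pi//= !mulr0 addr0.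
  rewrite big_split /= -!mulr_sumr c1.
  by have [_ _ ->] := vertex i Pi; rewrite !mulr1 subrK.
have := cmax (\row_j be j); rewrite inE /=.
have -> : (\row_j be j : 'rV[K]_n) ord0 = be by apply/funext => j; rewrite mxE.
move=> /(_ sb); rewrite (obj_diff x (c ord0) be).
have -> : \sum_j be j * slope x (c ord0) j =
    (1 - t) * \sum_j c ord0 j * slope x (c ord0) j + t * slope x (c ord0) i.
  rewrite -(vsum (slope x (c ord0))) !mulr_sumr -big_split /=.
  by apply: eq_bigr => j _; rewrite /be; ring.
have -> : comb be - comb (c ord0) = t *: (g i - comb (c ord0)).
  have -> : comb be = (1 - t) *: comb (c ord0) + t *: g i.
    have -> : g i = \sum_j (j == i)%:R *: g j.
      rewrite (bigD1 i)//= eqxx scale1r big1 ?addr0// => j /negPf ->.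
      by rewrite scale0r.
    rewrite /comb !scaler_sumr -big_split /=; apply: eq_bigr => j _.
    by rewrite !scalerA -scalerDl.
  by rewrite scalerBl scale1r scalerBr addrAC (addrAC (comb _)) subrr add0r addrC.
rewrite dotZl dotZr => h.
rewrite -(ler_pM2l t0).
by move: h; rewrite /D /Q; lra.
Qed.

End MaxAffine.

(** * Smoothness and strong convexity of the regularised maximum *)

Section MoreauMax.
Context {K : realType} {d n : nat}.
Variables (q L : K) (g : 'I_n -> 'rV[K]_d) (e : 'I_n -> K).
Variable argw : 'rV[K]_d -> 'I_n -> K.
Hypotheses (q0 : 0 <= q) (q1 : q < 1) (L0 : 0 < L).
Hypothesis argwP : forall x, kkt_on (1 - q) g e predT x (argw x).
Implicit Types (x y : 'rV[K]_d) (al : 'I_n -> K).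

Definition maxF x : K := obj (1 - q) g e x (argw x) + q / 2 * dotr x x.
Definition maxG x : 'rV[K]_d := comb g (argw x) + q *: x.

Let qb0 : 0 < 1 - q. Proof. by rewrite subr_gt0. Qed.

(** Applying [kkt_max] in both directions makes the quadratic gap vanish. Any KKT weights thus give
    value and gradient, whatever [argw] selects. *)
Lemma kkt_maxFG x al : kkt_on (1 - q) g e predT x al ->
  maxF x = obj (1 - q) g e x al + q / 2 * dotr x x /\
  maxG x = comb g al + q *: x.
Proof.
move=> h; have [s1 _] := h; have [s2 _] := argwP x.
have h1 := kkt_max qb0 h s2; have h2 := kkt_max qb0 (argwP x) s1.
set u := comb g (argw x) in h1 h2 *; set v := comb g al in h1 h2 *.
have q2 : 0 < 2 * (1 - q) by rewrite mulr_gt0.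
have z1 : 0 <= dotr (u - v) (u - v) / (2 * (1 - q)).
  by rewrite divr_ge0 ?dot_ge0 ?(ltW q2).
have z2 : 0 <= dotr (v - u) (v - u) / (2 * (1 - q)).
  by rewrite divr_ge0 ?dot_ge0 ?(ltW q2).
have eo : obj (1 - q) g e x (argw x) = obj (1 - q) g e x al by lra.
split; rewrite /maxF /maxG ?eo// -/u; congr (_ + _).
have z : dotr (u - v) (u - v) / (2 * (1 - q)) = 0 by lra.
apply/eqP; rewrite -subr_eq0; apply/eqP/dot_eq0.
by move/eqP: z; rewrite mulf_eq0 invr_eq0 (gt_eqF q2) orbF => /eqP.
Qed.

Local Notation M x := (obj (1 - q) g e x (argw x)).
Local Notation C x := (comb g (argw x)).

(** The weights optimal at x compete at y; the quadratic term is the gap of [kkt_max]. *)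
Lemma obj_max_lower x y : M x + dotr (C x) (y - x)
  + dotr (C x - C y) (C x - C y) / (2 * (1 - q)) <= M y.
Proof.
have [s _] := argwP x; have := kkt_max qb0 (argwP y) s.
by apply: le_trans; rewrite lerD2r dotBr /obj; lra.
Qed.

Lemma obj_max_coco x y : dotr (C x - C y) (C x - C y)
  <= (1 - q) * dotr (C x - C y) (x - y).
Proof.
have h1 := obj_max_lower x y; have h2 := obj_max_lower y x.
move: h1 h2; rewrite -(opprB (C x) (C y)) -(opprB x y).
rewrite !(dotNl (C x - C y)) !dotNr opprK.
rewrite [dotr (C x - C y) (x - y)]dotBl.
set w := x - y; set D := dotr (C x - C y) (C x - C y).
have -> : D / (2 * (1 - q)) = D / 2 / (1 - q) by field; rewrite gt_eqF.
set E := D / 2 / (1 - q) => h1 h2.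
have -> : D = 2 * (1 - q) * E by rewrite /E; field; rewrite gt_eqF.
have : 2 * E <= dotr (C x) w - dotr (C y) w by lra.
by rewrite -(ler_pM2l qb0); lra.
Qed.

Lemma obj_max_lip x y : enorm (C x - C y) <= (1 - q) * enorm (x - y).
Proof.
have [->|h] := eqVneq (enorm (C x - C y)) 0.
  by rewrite mulr_ge0 ?enorm_ge0 ?ltW.
have p : 0 < enorm (C x - C y) by rewrite lt_neqAle eq_sym h enorm_ge0.
rewrite -(ler_pM2l p) -expr2 enorm_sqr; apply: (le_trans (obj_max_coco x y)).
by rewrite mulrCA ler_pM2l// dot_le_enorm.
Qed.

Let dot_maxG x y : dotr (maxG x) y = dotr (C x) y + q * dotr x y.
Proof. by rewrite /maxG dotDl dotZl. Qed.

Lemma maxF_lower x y :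
  maxF x + dotr (maxG x) (y - x) + q / 2 * dotr (y - x) (y - x) <= maxF y.
Proof.
have := obj_max_lower x y.
have : 0 <= dotr (C x - C y) (C x - C y) / (2 * (1 - q)).
  by rewrite divr_ge0 ?dot_ge0 ?mulr_ge0 ?(ltW qb0).
rewrite dot_maxG /maxF; set D := _ / (2 * (1 - q)).
set m := M x; set m' := M y; set c := dotr (C x) (y - x); clearbody D m m' c.
rewrite !(dotBl y, dotBr y, dotBr x) (dotC y x).
by lra.
Qed.

(** [obj_max_lower] based at y, combined with the square |C y - C x - (1 - q) (y - x)|^2 >= 0,
    becomes an upper tangent at x with curvature 1 - q; the term q/2 |.|^2 adds q. *)
Lemma maxF_upper x y :
  maxF y <= maxF x + dotr (maxG x) (y - x) + 2^-1 * dotr (y - x) (y - x).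
Proof.
have h := obj_max_lower y x.
have := dot_ge0 (C y - C x - (1 - q) *: (y - x)).
have sq u v : dotr (u - (1 - q) *: v) (u - (1 - q) *: v) =
    dotr u u - 2 * (1 - q) * dotr u v + (1 - q) ^+ 2 * dotr v v.
  by rewrite dotBl !dotBr (dotC (_ *: _) u) !dotZr dotZl; ring.
rewrite sq; move: h; rewrite -(opprB y x) dotNr.
set w := y - x; set D := dotr (C y - C x) (C y - C x).
rewrite [dotr (C y - C x) w]dotBl => h.
rewrite dot_maxG /maxF.
have -> : dotr y y = dotr x x + 2 * dotr x w + dotr w w.
  have ey v : y = x + v -> dotr y y = dotr x x + 2 * dotr x v + dotr v v.
    by move=> ->; rewrite dotDl !dotDr (dotC v x); ring.
  by apply: ey; rewrite /w addrC subrK.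
move: h; set m := M x; set m' := M y; set c := dotr (C x) w.
set c' := dotr (C y) w; clearbody m m' c c'.
have -> : D / (2 * (1 - q)) = D / 2 / (1 - q) by field; rewrite gt_eqF.
set E := D / 2 / (1 - q) => h1.
have -> : D = 2 * (1 - q) * E by rewrite /E; field; rewrite gt_eqF.
move=> h2.
have : 0 <= 2 * E - 2 * (c' - c) + (1 - q) * dotr w w.
  by rewrite -(pmulr_rge0 _ qb0); lra.
by lra.
Qed.

Lemma maxF_grad x : differentiable (fun z => L * maxF z) x /\
  grad (fun z => L * maxF z) x = L *: maxG x.
Proof.
apply: (@quadratic_differentiable _ _ _ _ _ (L / 2)) => y.
have := maxF_upper x y; have := maxF_lower x y.
rewrite -(ler_pM2l L0) => h1; rewrite -(ler_pM2l L0) => h2.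
rewrite dotZl ler_norml.
have h3 : 0 <= L * q / 2 * dotr (y - x) (y - x).
  by rewrite mulr_ge0 ?dot_ge0 ?divr_ge0 ?mulr_ge0 ?(ltW L0).
have h4 : 0 <= L / 2 * dotr (y - x) (y - x).
  by rewrite mulr_ge0 ?dot_ge0 ?divr_ge0 ?(ltW L0).
by apply/andP; split; lra.
Qed.

Lemma maxF_smooth : smooth_strongly_convex (q * L) L (fun z => L * maxF z).
Proof.
split=> [x|x y t /andP[t0 t1]|x y]; first by have [] := maxF_grad x.
- set z := t *: x + (1 - t) *: y.
  have h1 := maxF_lower z x; have h2 := maxF_lower z y.
  have ex : x - z = (1 - t) *: (x - y).
    by apply/rowP => i; rewrite !mxE; ring.
  have ey : y - z = - (t *: (x - y)).
    by apply/rowP => i; rewrite !mxE; ring.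
  move: h1 h2; rewrite ex ey !dotNr !dotNl opprK !dotZr !dotZl => h1 h2.
  rewrite enorm_sqr.
  have t2 : 0 <= 1 - t by rewrite subr_ge0.
  have := ler_wpM2l t0 h1; have := ler_wpM2l t2 h2.
  set m := maxF z; set D := dotr (x - y) (x - y); set c := dotr (maxG z) (x - y).
  set fx := maxF x; set fy := maxF y => h3 h4.
  have h5 : m <= t * fx + (1 - t) * fy - q / 2 * t * (1 - t) * D by lra.
  by have := ler_wpM2l (ltW L0) h5; lra.
have [_ ->] := maxF_grad x; have [_ ->] := maxF_grad y.
rewrite -scalerBr /maxG.
rewrite enorm_le ?mulr_ge0 ?enorm_ge0 ?(ltW L0)// exprMn enorm_sqr dotZl dotZr.
rewrite mulrA -expr2 ler_wpM2l ?sqr_ge0//.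
have -> : C x + q *: x - (C y + q *: y) = (C x - C y) + q *: (x - y).
  by rewrite opprD addrACA -scalerBr.
have := obj_max_lip x y; rewrite enorm_le; last first.
  by rewrite mulr_ge0 ?enorm_ge0 ?(ltW qb0).
rewrite exprMn enorm_sqr => h1.
have h2 := le_trans (dot_le_enorm (C x - C y) (x - y))
  (ler_wpM2r (enorm_ge0 _) (obj_max_lip x y)).
rewrite -mulrA -expr2 enorm_sqr in h2.
have sq u v : dotr (u + q *: v) (u + q *: v) =
    dotr u u + 2 * q * dotr u v + q ^+ 2 * dotr v v.
  by rewrite dotDl !dotDr (dotC (q *: _) u) !dotZr dotZl; ring.
rewrite sq; have := ler_wpM2l q0 h2.
by lra.
Qed.

End MoreauMax.

(** * Inequalities between the affine pieces, in coordinates *)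

Section ChainScalars.
Context {K : realType}.
Variables (N : nat) (q : K) (gam xi tau A : nat -> K).
Hypotheses (q0 : 0 <= q) (q1 : q < 1) (ch : chain N q gam xi tau A).

Definition xi_sqr : K := \sum_(l < N.+1) xi l ^+ 2.

(* Index N.+1 stands for the piece that is active at the minimiser. *)
Definition height (i : nat) : K := q * xi_sqr / (2 * (1 - q)) +
  if i == N.+1 then 0
  else (gam i * xi i + q * \sum_(l < i) tau l * xi l - q * xi_sqr) / (1 - q).

Definition affine (Y : nat -> K) (i : nat) : K := height i +
  if i == N.+1 then q * \sum_(l < N.+1) xi l * Y l
  else gam i * Y i + q * \sum_(l < i) tau l * Y l.

Let qb0 : 0 < 1 - q. Proof. by rewrite subr_gt0. Qed.

Lemma chain_gam_gt0 k : (k <= N)%N -> 0 < gam k.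
Proof. by move=> /(chain_gam ch)/andP[]. Qed.

Lemma chain_xi_gt0 k : (k <= N)%N -> 0 < xi k.
Proof. by move=> /(chain_gam ch)/andP[h1]; exact: lt_trans. Qed.

Lemma chain_slack k : (k <= N)%N -> q * xi k <= A k * gam k.
Proof.
rewrite leq_eqVlt => /orP[/eqP->|kN]; first exact: chain_A_last ch.
rewrite -subr_ge0 -(chain_A_rec ch kN) mulr_ge0 ?(chain_A_ge0 ch)//.
exact/ltW/(chain_pos ch).
Qed.

(** Makes the masses A_k - A_{k+1} nonnegative; the reason is q A_k tau_k <= q xi_k, from A_k <= 1
    and tau_k <= xi_k. *)
Lemma chain_A_le k : (k < N)%N -> A k.+1 <= A k.
Proof.
have step j : (j < N)%N -> A j <= 1 -> A j.+1 <= A j.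
  move=> jN A1; rewrite -(ler_pM2r (chain_pos ch jN)) (chain_A_rec ch jN).
  have h1 := ler_wpM2l (chain_A_ge0 ch (ltnW jN)) (chain_tau ch jN).
  have h2 := ler_wpM2r (ltW (chain_xi_gt0 (ltnW jN))) A1.
  by have := ler_wpM2l q0 (le_trans h1 h2); lra.
have le1 j : (j <= N)%N -> A j <= 1.
  elim: j => [_|j IH jN]; first by rewrite (chain_A0 ch).
  by apply: le_trans (step _ jN (IH (ltnW jN))) (IH (ltnW jN)).
by move=> kN; apply: step => //; apply: le1; exact: ltnW.
Qed.

Lemma affine_step Y k : (k < N)%N -> affine Y k - affine Y k.+1 =
  (gam k - q * tau k) * (Y k + gam k / (1 - q)) - gam k.+1 * Y k.+1.
Proof.
move=> kN; rewrite /affine /height !ltn_eqF ?ltnS//; last exact: ltnW.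
rewrite [\sum_(l < k.+1) tau l * xi l]big_ord_recr.
rewrite [\sum_(l < k.+1) tau l * Y l]big_ord_recr /= (chain_prod ch kN).
by field; rewrite gt_eqF.
Qed.

(** With the coordinates beyond k zero, each difference of [affine_step] from k on is a product of
    nonnegative factors. The condition on Y k holds at the proximal point because piece k has weight
    at most 1 there. *)
Lemma affine_tail Y k : (k <= N)%N -> (forall l, (k < l <= N)%N -> Y l = 0) ->
  0 <= Y k + gam k / (1 - q) ->
  forall j, (k <= j <= N)%N -> affine Y j <= affine Y k.
Proof.
move=> kN Y0 Yk j /andP[kj]; rewrite -(subnKC kj).
elim: (j - k)%N => [|i IH] h; first by rewrite addn0.
rewrite addnS in h *; apply: le_trans (IH (ltnW h)).
rewrite -subr_ge0 affine_step// (Y0 (k + i).+1) ?h ?andbT ?ltnS ?leq_addr//.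
rewrite mulr0 subr0 mulr_ge0 ?(ltW (chain_pos ch h))//.
case: i h {IH} => [|i] h; first by rewrite addn0.
rewrite Y0 ?add0r ?divr_ge0 ?(ltW qb0) ?(ltW (chain_gam_gt0 (ltnW h)))//.
by rewrite (ltnW h) andbT addnS ltnS leq_addr.
Qed.

(** [chain_A_rec] is what cancels the coefficients of Y_0, ..., Y_{k-1}; only Y_k and the
    coordinates beyond k survive. *)
Lemma affine_mix Y k : (k <= N)%N ->
  \sum_(i < k) (A i - A i.+1) * affine Y i + A k * affine Y k - affine Y N.+1 =
  (A k * (gam k * xi k) - q * (xi_sqr - \sum_(l < k) xi l ^+ 2)) / (1 - q)
  + (A k * gam k - q * xi k) * Y k
  - q * (\sum_(l < N.+1) xi l * Y l - \sum_(l < k.+1) xi l * Y l).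
Proof.
elim: k => [_|k IH kN].
  rewrite !big_ord0 (chain_A0 ch) /affine /height eqxx /= !big_ord0 big_ord1.
  by field; rewrite gt_eqF.
have {}IH := IH (ltnW kN).
have rA := chain_A_rec ch kN.
have st := affine_step Y kN.
rewrite big_ord_recr /=.
have -> : \sum_(i < k) (A i - A i.+1) * affine Y i + (A k - A k.+1) * affine Y k
   + A k.+1 * affine Y k.+1 - affine Y N.+1 =
  \sum_(i < k) (A i - A i.+1) * affine Y i + A k * affine Y k - affine Y N.+1
   - A k.+1 * (affine Y k - affine Y k.+1) by ring.
rewrite IH st (chain_prod ch kN).
rewrite [\sum_(l < k.+1) xi l ^+ 2]big_ord_recr /=.
rewrite [\sum_(l < k.+2) xi l * Y l]big_ord_recr /=.
have -> : A k.+1 * ((gam k - q * tau k) * (Y k + gam k / (1 - q))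
    - gam k.+1 * Y k.+1) =
  (A k * gam k - q * xi k) * (Y k + gam k / (1 - q))
    - A k.+1 * gam k.+1 * Y k.+1 by rewrite -rA; ring.
have -> : A k.+1 * ((gam k - q * tau k) * (xi k - gam k)) =
  (A k * gam k - q * xi k) * (xi k - gam k) by rewrite -rA; ring.
by field; rewrite gt_eqF.
Qed.

(** This is 1 - q times the value of [affine_mix] at the extreme Y_k = - gamma_k / (1 - q), with
    zeros beyond. It exceeds its successor by gamma_{k+1} (A_{k+1} gamma_{k+1} - q xi_{k+1}), and at
    N it factors as (xi_N - gamma_N) (A_N gamma_N - q xi_N). *)
Lemma mix_const_ge0 k : (k <= N)%N ->
  0 <= A k * (gam k * xi k) - q * (xi_sqr - \sum_(l < k) xi l ^+ 2)
    - gam k * (A k * gam k - q * xi k).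
Proof.
move: k; apply: down_ind => [|k kN].
  rewrite /xi_sqr big_ord_recr /=.
  have /andP[g0 gx] := chain_gam ch (leqnn N).
  have : 0 <= (xi N - gam N) * (A N * gam N - q * xi N).
    by rewrite mulr_ge0 ?subr_ge0 ?(ltW gx) ?chain_slack.
  by lra.
have : 0 <= gam k.+1 * (A k.+1 * gam k.+1 - q * xi k.+1).
  by rewrite mulr_ge0 ?subr_ge0 ?chain_slack// ltW// chain_gam_gt0.
rewrite (chain_prod ch kN) big_ord_recr /=.
have -> : A k.+1 * ((gam k - q * tau k) * (xi k - gam k)) =
  (A k * gam k - q * xi k) * (xi k - gam k) by rewrite -(chain_A_rec ch kN); ring.
by lra.
Qed.

Lemma affine_star Y k : (k <= N)%N -> (forall l, (k < l <= N)%N -> Y l = 0) ->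
  0 <= Y k + gam k / (1 - q) -> affine Y N.+1 <=
    \sum_(i < k) (A i - A i.+1) * affine Y i + A k * affine Y k.
Proof.
move=> kN Y0 Yk; rewrite -subr_ge0 affine_mix//.
have -> : \sum_(l < N.+1) xi l * Y l = \sum_(l < k.+1) xi l * Y l.
  rewrite -!(big_mkord xpredT (fun l => xi l * Y l)).
  rewrite (big_cat_nat (n := k.+1))//= -[RHS]addr0; congr (_ + _).
  by rewrite big_nat big1// => l lN; rewrite Y0 ?mulr0.
rewrite subrr mulr0 subr0.
have h1 := mix_const_ge0 kN.
have : 0 <= (A k * gam k - q * xi k) * (Y k + gam k / (1 - q)).
  by rewrite mulr_ge0// subr_ge0 chain_slack.
move: h1; set B := A k * gam k - q * xi k.
set Cc := _ - q * _ => h1 h2.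
have : 0 <= (Cc - gam k * B) / (1 - q) by rewrite divr_ge0 ?(ltW qb0).
by move: h2; lra.
Qed.

End ChainScalars.

Definition orthonormal {K : realType} {d : nat} (N : nat) (u : nat -> 'rV[K]_d) : Prop :=
  forall i j, (i < N)%N -> (j < N)%N -> dotr (u i) (u j) = (i == j)%:R.

Lemma sum_delta (K : realType) (n i : nat) (h : nat -> K) :
  \sum_(l < n) h l * (i == l)%:R = if (i < n)%N then h i else 0.
Proof.
case: ifP => [iN|iN].
  rewrite (bigD1 (Ordinal iN))//= eqxx mulr1 big1 ?addr0// => l lN.
  rewrite (_ : (i == l) = false) ?mulr0//; apply/negbTE; apply: contra lN => /eqP e.
  by apply/eqP/val_inj.
rewrite big1// => l _; rewrite (_ : (i == l) = false) ?mulr0//.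
by apply/negbTE/eqP => e; move: iN; rewrite e ltn_ord.
Qed.

Section WorstCase.
Context {K : realType} {d : nat}.
Variables (N : nat) (q : K) (gam xi tau A : nat -> K).
Hypotheses (q0 : 0 <= q) (q1 : q < 1) (ch : chain N q gam xi tau A).
Implicit Types (u : nat -> 'rV[K]_d) (x : 'rV[K]_d) (al : 'I_N.+2 -> K).

Definition piece u (i : 'I_N.+2) : 'rV[K]_d :=
  if i == N.+1 :> nat then \sum_(l < N.+1) (q * xi l) *: u l
  else gam i *: u i + \sum_(l < i) (q * tau l) *: u l.

Local Notation ht := (height N q gam xi tau).
Local Notation aff := (affine N q gam xi tau).
Local Notation kkt u := (kkt_on (1 - q) (piece u) ht).

Let qb0 : 0 < 1 - q. Proof. by rewrite subr_gt0. Qed.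

Lemma dot_piece u (i : 'I_N.+2) x : ht i + dotr (piece u i) x =
  aff (fun l => dotr (u l) x) i.
Proof.
rewrite /piece /affine; congr (_ + _); case: eqP => _.
  by rewrite dot_suml mulr_sumr; apply: eq_bigr => l _; rewrite dotZl mulrA.
rewrite dotDl dotZl dot_suml; congr (_ + _); rewrite mulr_sumr.
by apply: eq_bigr => l _; rewrite dotZl mulrA.
Qed.

Lemma slopeE u x al (i : 'I_N.+2) : slope (1 - q) (piece u) ht x al i =
  aff (fun l => dotr (u l) (x - (1 - q)^-1 *: comb (piece u) al)) i.
Proof. exact: dot_piece. Qed.

Lemma dot_u_piece u l (i : 'I_N.+2) : orthonormal N.+1 u -> (l <= N)%N ->
  (i <= N)%N -> dotr (u l) (piece u i) =
    gam l * (l == i)%:R + (if (l < i)%N then q * tau l else 0).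
Proof.
move=> ou lN iN; rewrite /piece ltn_eqF// dotDr dotZr dot_sumr ou//.
congr (_ + _); first by case: eqP => [->|_]; rewrite ?mulr0.
rewrite -(sum_delta i l (fun l => q * tau l)); apply: eq_bigr => j _.
by rewrite dotZr ou// ltnS (leq_trans _ iN)// ltnW.
Qed.

Definition upto k : pred 'I_N.+2 := fun i => (i <= k)%N.

(** Pieces 0, ..., k involve only u_0, ..., u_k, so weights carried by them ignore the directions
    still to be chosen. *)
Lemma kkt_agree u u' k x al : (k <= N)%N ->
  (forall l, (l <= k)%N -> u l = u' l) -> simplex_on (upto k) al ->
  comb (piece u) al = comb (piece u') al /\
  (forall i, upto k i -> slope (1 - q) (piece u) ht x al i =
    slope (1 - q) (piece u') ht x al i).
Proof.
move=> kN uu [_ aP _].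
have pe (i : 'I_N.+2) : (i <= k)%N -> piece u i = piece u' i.
  move=> ik; rewrite /piece ltn_eqF ?ltnS ?(leq_trans ik)// uu//; congr (_ + _).
  by apply: eq_bigr => l _; rewrite uu// ltnW// (leq_trans (ltn_ord l)).
have ec : comb (piece u) al = comb (piece u') al.
  rewrite /comb; apply: eq_bigr => i _; have [/pe->//|ik] := boolP (upto k i).
  by rewrite aP// !scale0r.
by split=> // i Pi; rewrite /slope ec (pe i Pi).
Qed.

Lemma kkt_on_agree u u' k x al : (k <= N)%N ->
  (forall l, (l <= k)%N -> u l = u' l) ->
  kkt u (upto k) x al -> kkt u' (upto k) x al.
Proof.
move=> kN uu [s h]; have [_ es] := kkt_agree x kN uu s; split=> // i Pi.
rewrite -es// (le_trans (h i Pi))// le_eqVlt; apply/orP; left; apply/eqP.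
have [_ aP _] := s; apply: eq_bigr => j _.
have [Pj|/aP->] := boolP (upto k j); last by rewrite !mul0r.
by rewrite es.
Qed.

(* A point orthogonal to u_k, ..., u_N only sees the pieces 0, ..., k: beyond k the
   slopes decrease along the chain, and the piece of the minimiser is dominated by
   a convex combination of the first k + 1 pieces. *)
Lemma zero_chain u k x al : (k <= N)%N -> orthonormal N.+1 u ->
  (forall l, (k <= l <= N)%N -> dotr (u l) x = 0) ->
  kkt u (upto k) x al -> kkt u predT x al.
Proof.
move=> kN ou xu [s h]; have [a0 aP a1] := s.
split; first by split=> // i.
pose M := \sum_j al j * slope (1 - q) (piece u) ht x al j.
rewrite -/M in h *.
pose Y l := dotr (u l) (x - (1 - q)^-1 *: comb (piece u) al).
have kN2 : (k < N.+2)%N by rewrite ltnS leqW.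
pose ok := Ordinal kN2.
(* Among the pieces 0, ..., k only piece k has a component on some u_l with l >= k, namely gamma_k
   on u_k. *)
have Ycomb l : (k <= l <= N)%N -> Y l = - (al ok * gam l * (l == k)%:R / (1 - q)).
  move=> /andP[kl lN]; rewrite /Y dotBr dotZr xu ?kl// add0r /comb dot_sumr.
  congr (- _); rewrite mulrC; congr (_ / _).
  rewrite (bigD1 ok)//= dotZr dot_u_piece//= ltnNge kl /= addr0 big1 => [|i ik].
    by rewrite addr0 mulrA.
  rewrite dotZr; have [Pi|/aP->] := boolP (upto k i); last by rewrite mul0r.
  rewrite dot_u_piece// ?(leq_trans Pi)// ltnNge (leq_trans Pi kl) /= addr0.
  rewrite (_ : (l == i) = false) ?mulr0//.
  apply/negbTE/eqP => e; move/negP: ik; apply; apply/eqP/val_inj => /=.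
  by apply/eqP; rewrite eqn_leq (Pi : (i <= k)%N) -e.
have Y0 l : (k < l <= N)%N -> Y l = 0.
  move=> /andP[kl lN]; rewrite Ycomb ?(ltnW kl)// gtn_eqF//.
  by rewrite mulr0 mul0r oppr0.
have Yk : 0 <= Y k + gam k / (1 - q).
  rewrite Ycomb ?leqnn// eqxx mulr1 addrC -mulrBl divr_ge0 ?(ltW qb0)//.
  have -> : gam k - al ok * gam k = (1 - al ok) * gam k by ring.
  by rewrite mulr_ge0 ?subr_ge0 ?(simplex_le1 _ s)// ltW// (chain_gam_gt0 ch).
have hle j : (j <= k)%N -> aff Y j <= M.
  move=> jk; have jN : (j < N.+2)%N by apply: leq_ltn_trans jk kN2.
  by have := h (Ordinal jN) jk; rewrite slopeE.
move=> i _; rewrite slopeE -/Y.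
have [ik|ki] := leqP i k; first exact: hle.
have [iN|Ni] := leqP i N.
  apply: le_trans (hle k (leqnn k)).
  by apply: (affine_tail q1 ch kN Y0 Yk); rewrite (ltnW ki).
have -> : i = N.+1 :> nat by apply/eqP; rewrite eqn_leq Ni -ltnS ltn_ord.
apply: le_trans (affine_star q1 ch kN Y0 Yk) _.
have -> : M = \sum_(j < k) (A j - A j.+1) * M + A k * M.
  rewrite -mulr_suml -mulrDl.
  have -> : \sum_(j < k) (A j - A j.+1) = 1 - A k.
    elim: (k) => [|m IH]; first by rewrite big_ord0 (chain_A0 ch) subrr.
    by rewrite big_ord_recr IH /=; ring.
  by rewrite subrK mul1r.
apply: lerD; last by rewrite ler_wpM2l ?(chain_A_ge0 ch) ?hle.
apply: ler_sum => j _; have jk := ltn_ord j.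
rewrite ler_wpM2l ?hle ?(ltnW jk)// subr_ge0.
by apply: (chain_A_le q0 ch); exact: leq_trans jk kN.
Qed.

Section Fixed.
Variables (u : nat -> 'rV[K]_d) (argw : 'rV[K]_d -> 'I_N.+2 -> K).
Hypothesis ou : orthonormal N.+1 u.
Hypothesis argwP : forall x, kkt u predT x (argw x).
Local Notation F := (maxF q (piece u) ht argw).
Local Notation G := (maxG q (piece u) argw).

Definition minimizer : 'rV[K]_d := - \sum_(l < N.+1) xi l *: u l.

Lemma dot_minimizer l : (l <= N)%N -> dotr (u l) minimizer = - xi l.
Proof.
move=> lN; rewrite /minimizer dotNr dot_sumr; congr (- _).
transitivity (\sum_(j < N.+1) xi j * (l == j)%:R).
  by apply: eq_bigr => j _; rewrite dotZr ou ?ltn_ord.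
by rewrite (sum_delta _ _ xi) ltnS lN.
Qed.

Lemma vertex_comb (i : 'I_N.+2) :
  comb (piece u) (fun j => (j == i)%:R) = piece u i /\
  \sum_j (j == i)%:R * ht j = ht i.
Proof.
split.
  rewrite /comb (bigD1 i)//= eqxx scale1r big1 ?addr0// => j /negPf ->.
  by rewrite scale0r.
rewrite (bigD1 i)//= eqxx mul1r big1 ?addr0// => j /negPf ->.
by rewrite mul0r.
Qed.

Lemma vertex_simplex (P : pred 'I_N.+2) (i : 'I_N.+2) : P i ->
  simplex_on P (fun j : 'I_N.+2 => (j == i)%:R : K).
Proof.
move=> Pi; split=> [j|j|]; first by rewrite ler0n.
- by case: eqVneq => // ->; rewrite Pi.
- by rewrite (bigD1 i)//= eqxx big1 ?addr0// => j /negPf ->.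
Qed.

Lemma minimizer_sqr : dotr minimizer minimizer = xi_sqr N xi.
Proof.
rewrite {1}/minimizer dotNl dot_suml /xi_sqr -sumrN; apply: eq_bigr => l _.
by rewrite dotZl dot_minimizer ?mulrN ?opprK ?expr2// -ltnS.
Qed.

Lemma piece_last : piece u ord_max = - (q *: minimizer).
Proof.
rewrite /piece eqxx /minimizer scalerN opprK scaler_sumr.
by apply: eq_bigr => l _; rewrite scalerA.
Qed.

(** The constants [height] are made for this: with all the weight on the last piece, all slopes at
    the minimiser coincide, so KKT holds with equality. The slope of that piece cancels the gradient
    of q/2 |.|^2, and the common term of [height] normalises the minimum to 0. *)
Lemma maxF_minimizer : F minimizer = 0 /\ G minimizer = 0.
Proof.
have [cE hE] := vertex_comb ord_max.
have kk : kkt u predT minimizer (fun j => (j == ord_max)%:R).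
  split; first exact: vertex_simplex.
  have ev (i : 'I_N.+2) : slope (1 - q) (piece u) ht minimizer
      (fun j => (j == ord_max)%:R) i = - (q * xi_sqr N xi / (2 * (1 - q))).
    rewrite slopeE cE piece_last scalerN opprK scalerA.
    have -> : minimizer + ((1 - q)^-1 * q) *: minimizer = (1 - q)^-1 *: minimizer.
      by rewrite -{1}[minimizer]scale1r -scalerDl; congr (_ *: _); field; rewrite gt_eqF.
    have sm (n : nat) (h : nat -> K) : (n <= N.+1)%N ->
        \sum_(l < n) h l * dotr (u l) ((1 - q)^-1 *: minimizer) =
        - ((\sum_(l < n) h l * xi l) / (1 - q)).
      move=> nN; rewrite mulr_suml -sumrN; apply: eq_bigr => l _.
      rewrite dotZr dot_minimizer; last by rewrite -ltnS (leq_trans (ltn_ord l)).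
      by ring.
    rewrite /affine /height; case: eqP => iN.
      rewrite sm// (_ : \sum_(l < N.+1) xi l * xi l = xi_sqr N xi).
        by field; rewrite gt_eqF.
      by apply: eq_bigr => l _; rewrite expr2.
    have iN' : (i <= N)%N.
      by rewrite -ltnS ltn_neqAle; apply/andP; split; [exact/eqP|rewrite -ltnS].
    rewrite sm ?leqW// dotZr dot_minimizer//.
    by field; rewrite gt_eqF.
  move=> i _; rewrite ev; under eq_bigr => j _ do rewrite ev.
  rewrite -mulr_suml; have [_ _ ->] := vertex_simplex (P := predT) (i := ord_max) isT.
  by rewrite mul1r.
have [-> ->] := kkt_maxFG q1 argwP kk.
rewrite /obj hE cE piece_last; have := minimizer_sqr.
move: minimizer => m em; rewrite !(dotNl, dotNr, dotZl, dotZr) em.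
rewrite /height eqxx; split; last by rewrite addNr.
by field; rewrite gt_eqF.
Qed.

Lemma maxF_ge0 x : 0 <= F x.
Proof.
have [F0 G0] := maxF_minimizer.
have := maxF_lower q1 argwP minimizer x; rewrite F0 G0 dot0l !add0r.
by apply: le_trans; rewrite mulr_ge0 ?dot_ge0 ?divr_ge0.
Qed.

(** [zero_chain] with k = 0: the origin sees piece 0 alone, so the initial condition is explicit in
    gamma_0 and xi. *)
Lemma maxF_origin : 2 * (1 - q) * F 0 =
    2 * (gam 0 * xi 0) - gam 0 ^+ 2 - q * xi_sqr N xi /\
  dotr (G 0) (G 0) = gam 0 ^+ 2.
Proof.
have [cE hE] := vertex_comb ord0.
have pE : piece u ord0 = gam 0 *: u 0%N by rewrite /piece /= big_ord0 addr0.
have kk : kkt u (upto 0) 0 (fun j => (j == ord0)%:R).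
  split; first exact: vertex_simplex.
  move=> i; rewrite /upto leqn0 => /eqP i0.
  have -> : i = ord0 by apply/val_inj.
  by rewrite (bigD1 ord0)//= mul1r big1 ?addr0// => j /negPf ->; rewrite mul0r.
have := zero_chain (leq0n N) ou (fun l _ => dot0r (u l)) kk.
move=> /(kkt_maxFG q1 argwP)[-> ->].
rewrite /obj hE cE pE scaler0 addr0 !(dotZl, dotZr) !dot0r ou//=.
rewrite /height /= big_ord0; split; last by ring.
by field; rewrite gt_eqF.
Qed.

(** Piece N alone bounds the envelope from below. As x misses u_N, the part depending on x is q/2 |x
    + sum_(l < N) tau_l u_l|^2 up to a constant, and this square is dropped. *)
Lemma maxF_hidden x : dotr (u N) x = 0 ->
  2 * (gam N * xi N) - gam N ^+ 2 - q * xi N ^+ 2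
    - q * \sum_(l < N) (xi l - tau l) ^+ 2 <= 2 * (1 - q) * F x.
Proof.
move=> xN.
have NN : (N < N.+2)%N by rewrite ltnS leqW.
pose i := Ordinal NN.
have [cE hE] := vertex_comb i.
have sv : simplex_on predT (fun j : 'I_N.+2 => (j == i)%:R : K).
  exact: vertex_simplex.
pose o1 := obj (1 - q) (piece u) ht x (argw x).
pose o2 := obj (1 - q) (piece u) ht x (fun j => (j == i)%:R).
have le12 : o2 <= o1.
  apply: le_trans (kkt_max qb0 (argwP x) sv); rewrite lerDl.
  by rewrite divr_ge0 ?dot_ge0 ?mulr_ge0 ?(ltW qb0).
have e : o2 = ht N + q * \sum_(l < N) tau l * dotr (u l) x
   - (gam N ^+ 2 + q ^+ 2 * \sum_(l < N) tau l ^+ 2) / (2 * (1 - q)).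
  rewrite /o2 /obj hE cE dot_piece /affine /= ltn_eqF// xN mulr0 add0r.
  congr (_ - _ / _).
  rewrite {1}/piece /= ltn_eqF// dotDl dotZl dot_suml dot_u_piece//=.
  rewrite eqxx ltnn mulr1 addr0 expr2; congr (_ + _).
  rewrite mulr_sumr; apply: eq_bigr => l _.
  rewrite dotZl dot_u_piece ?(ltnW (ltn_ord l))//= ltn_ord ltn_eqF//.
  by rewrite mulr0 add0r; ring.
set v := x + \sum_(l < N) tau l *: u l.
have := dot_ge0 v; rewrite /v.
set t := \sum_(l < N) tau l *: u l.
have sq (y z : 'rV[K]_d) : dotr (y + z) (y + z) = dotr y y + 2 * dotr z y + dotr z z.
  by rewrite dotDl !dotDr (dotC y z); ring.
rewrite sq.
have -> : dotr t x = \sum_(l < N) tau l * dotr (u l) x.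
  by rewrite dot_suml; apply: eq_bigr => l _; rewrite dotZl.
have -> : dotr t t = \sum_(l < N) tau l ^+ 2.
  rewrite {1}/t dot_suml; apply: eq_bigr => l _; rewrite dotZl /t dot_sumr.
  rewrite (_ : \sum_(j < N) _ = tau l) ?expr2//.
  transitivity (\sum_(j < N) tau j * (l == j)%:R).
    by apply: eq_bigr => j _; rewrite dotZr ou// ltnW// ltnS ltn_ord.
  by rewrite (sum_delta _ _ tau) ltn_ord.
have -> : \sum_(l < N) (xi l - tau l) ^+ 2 = \sum_(l < N) xi l ^+ 2
    - 2 * (\sum_(l < N) tau l * xi l) + \sum_(l < N) tau l ^+ 2.
  rewrite mulr_sumr -sumrB -big_split; apply: eq_bigr => l _ /=; ring.
rewrite /maxF -/o1; move: e; rewrite /height ltn_eqF// /xi_sqr big_ord_recr /=.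
clearbody o1 o2.
move: (\sum_(l < N) tau l * dotr _ _) (\sum_(l < N) tau l ^+ 2)
  (\sum_(l < N) xi l ^+ 2) (\sum_(l < N) tau l * xi l) => S1 S2 S3 S4 e h.
have h1 := ler_wpM2l (mulr_ge0 q0 (ltW qb0)) h.
have h2 := ler_wpM2l (ltW qb0) le12.
have e' : 2 * (1 - q) * o2 = q * (S3 + xi N ^+ 2)
    + 2 * (gam N * xi N + q * S4 - q * (S3 + xi N ^+ 2))
    + 2 * (1 - q) * q * S1 - (gam N ^+ 2 + q ^+ 2 * S2).
  by rewrite e; field; rewrite gt_eqF.
by lra.
Qed.

End Fixed.
End WorstCase.

(** * The resisting oracle *)

Lemma unit_orthogonal (K : realType) (d : nat) (s : seq 'rV[K]_d) :
  (size s < d)%N -> exists w, dotr w w = 1 /\ forall v, v \in s -> dotr w v = 0.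
Proof.
move=> sd; pose B : 'M[K]_(d, size s) := \matrix_(i, j) (s`_j) ord0 i.
have kB : kermx B != 0.
  rewrite kermx_eq0 /row_free neq_ltn; apply/orP; left.
  by apply: leq_ltn_trans (rank_leq_col B) sd.
have [i [j ij]] : exists i j, kermx B i j != 0.
  by have /matrix0Pn[i [j h]] := kB; exists i, j.
pose w0 := row i (kermx B).
have w0s v : v \in s -> dotr w0 v = 0.
  move=> vs; have e : w0 *m B = 0 by rewrite /w0 -row_mul mulmx_ker row0.
  have h : (index v s < size s)%N by rewrite index_mem.
  have := congr1 (fun A : 'rV[K]_(size s) => A ord0 (Ordinal h)) e.
  rewrite !mxE => <-; apply: eq_bigr => l _.
  by rewrite [B _ _]mxE /= nth_index.
have w00 : 0 < dotr w0 w0.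
  rewrite lt_neqAle dot_ge0 andbT eq_sym; apply/eqP => /dot_eq0 w00.
  move/eqP: ij; apply; have := congr1 (fun A : 'rV[K]_d => A ord0 j) w00.
  by rewrite !mxE.
exists ((Num.sqrt (dotr w0 w0))^-1 *: w0); split=> [|v vs].
  rewrite dotZl dotZr mulrA -invfM -expr2 sqr_sqrtr ?dot_ge0//.
  by rewrite mulVf// gt_eqF.
by rewrite dotZl (w0s v vs) mulr0.
Qed.

Section Resisting.
Context {K : realType} {d : nat}.
Variables (N : nat) (q L : K) (gam xi tau A : nat -> K).
Hypotheses (q0 : 0 <= q) (q1 : q < 1) (L0 : 0 < L) (ch : chain N q gam xi tau A).
Hypotheses (N1 : (1 <= N)%N) (dN : (2 * N + 1 <= d)%N).
Variable M : fo_method K d.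
Local Notation ht := (height N q gam xi tau).
Local Notation pcs u := (piece (N := N) q gam xi tau u).
Variable W : (nat -> 'rV[K]_d) -> 'rV[K]_d -> 'I_N.+2 -> K.
Hypothesis WP : forall u x, kkt_on (1 - q) (pcs u) ht predT x (W u x).

Definition hard_function u (z : 'rV[K]_d) : K := L * maxF q (pcs u) ht (W u) z.

(** The order of quantifiers is the point: a single answer, computed from v_0, ..., v_k, fits every
    completion u for which y is orthogonal to u_k, ..., u_N. *)
Lemma answer_exists v k y : (k <= N)%N -> exists ans,
  forall u, orthonormal N.+1 u -> (forall l, (l <= k)%N -> v l = u l) ->
  (forall l, (k <= l <= N)%N -> dotr (u l) y = 0) -> oracle (hard_function u) y = ans.
Proof.
move=> kN; have qb0 : 0 < 1 - q by rewrite subr_gt0.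
have [al kal] := kkt_exists (pcs v) ht qb0 (P := upto k) y (i0 := ord0) isT.
exists (L * (obj (1 - q) (pcs v) ht y al + q / 2 * dotr y y),
  L *: (comb (pcs v) al + q *: y)) => u ou vu uy.
have kau := kkt_on_agree kN vu kal.
have [eF eG] := kkt_maxFG q1 (WP u) (zero_chain q0 q1 ch kN ou uy kau).
have [s _] := kal; have [ec _] := kkt_agree q gam xi tau y kN vu s.
have [_ gr] := maxF_grad q0 q1 L0 (WP u) y.
by rewrite /oracle /hard_function gr eF eG /obj ec.
Qed.

Lemma orthonormal_extend k v s : (k + size s < d)%N -> orthonormal k v ->
  exists w : nat -> 'rV[K]_d, [/\ orthonormal k.+1 w,
    forall l, (l < k)%N -> w l = v l & forall y, y \in s -> dotr (w k) y = 0].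
Proof.
move=> ks ov.
have [|w [w1 wo]] := @unit_orthogonal K d ([seq v i | i <- iota 0 k] ++ s).
  by rewrite size_cat size_map size_iota.
have wv i : (i < k)%N -> dotr w (v i) = 0.
  by move=> ik; apply: wo; rewrite mem_cat map_f ?mem_iota.
exists (fun l => if l == k then w else v l); split.
- move=> i j; rewrite !ltnS => ik jk.
  case: eqP => [->|/eqP ni]; case: eqP => [->|/eqP nj]; rewrite ?eqxx//.
  + by rewrite wv ?ltn_neqAle ?nj// eq_sym (negPf nj).
  + by rewrite dotC wv ?ltn_neqAle ?ni// (negPf ni).
  + by rewrite ov// ltn_neqAle ?ni ?nj.
- by move=> l lk; rewrite ltn_eqF.
- by move=> y ys; rewrite eqxx wo// mem_cat ys orbT.
Qed.

(* The first query is at the origin, which is orthogonal to everything: this is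
   why Ys needs only k - 1 points, and dimension 2 N + 1 suffices. *)
Lemma resisting_prefix k : (k <= N)%N -> exists v Ys h,
  [/\ (size Ys <= k.-1)%N, orthonormal k v, k = 0%N -> h = [::] &
  forall u, orthonormal N.+1 u -> (forall l, (l < k)%N -> u l = v l) ->
    (forall y, y \in Ys -> forall l, (k <= l <= N)%N -> dotr (u l) y = 0) ->
    iter k (ask M (hard_function u) 0) [::] = h].
Proof.
elim: k => [_|k IH kN].
  by exists (fun=> 0), [::], [::]; split.
have [v [Ys [h [sY ov h0 hu]]]] := IH (ltnW kN).
(* The empty history stands for the imposed query at 0. If the method stops, y below is the dummy
   point 0, orthogonal to everything. *)
pose nx := if h is [::] then Some 0 else query M 0 h.
pose y := odflt 0 nx.
pose Ys' := if h is [::] then Ys else y :: Ys.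
have sY' : (size Ys' <= k)%N.
  rewrite /Ys'; case: (h) h0 => [_|p h' h0] /=; first exact: leq_trans sY (leq_pred k).
  by case: (k) sY h0 => [_ /(_ erefl)//|k' sY _].
have [|w [ow wv wY]] := @orthonormal_extend k v Ys' _ ov.
  apply: leq_ltn_trans (leq_add (leqnn k) sY') _.
  by rewrite (leq_trans _ dN)// addn1 ltnS addnn mul2n leq_double ltnW.
have [ans ansP] := answer_exists w y (ltnW kN).
exists w, Ys', (if nx is Some _ then (if h is [::] then [:: ans] else rcons h ans) else h).
split=> // u ou uw uY.
have subY z : z \in Ys -> z \in Ys'.
  by rewrite /Ys'; case: (h) => // p h' zY; rewrite inE zY orbT.
have uY' z l : z \in Ys' -> (k <= l <= N)%N -> dotr (u l) z = 0.
  move=> zY /andP[]; rewrite leq_eqVlt => /orP[/eqP<- _|kl lN].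
    by rewrite uw// wY.
  by apply: uY => //; rewrite kl.
have -> : iter k.+1 (ask M (hard_function u) 0) [::] = ask M (hard_function u) 0 h.
  rewrite iterS hu// => [l lk|z zY l kl]; last by apply: uY'; [exact: subY|].
  by rewrite uw ?wv// ltnW.
have uy l : (k <= l <= N)%N -> dotr (u l) y = 0.
  move: uY'; rewrite /Ys' /y /nx; case: (h) => [|p h'] uY'; first by rewrite dot0r.
  by apply: uY'; rewrite inE eqxx.
have ea := ansP u ou (fun l lk => esym (uw l lk)) uy.
move: ea; rewrite /y /nx /ask; case: (h) => [|p h'] /=; first by move=> ->.
by case: (query M 0 (p :: h')) => //= z ->.
Qed.

(** u_N is chosen after all answers are fixed, orthogonal to N directions, at most N - 1 queries and
    the output: at most 2 N vectors, hence dimension 2 N + 1. *)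
Lemma resisting : exists u, orthonormal N.+1 u /\
  dotr (u N) (run N M (hard_function u) 0) = 0.
Proof.
have [v [Ys [h [sY ov _ hu]]]] := resisting_prefix (leqnn N).
have [|w [ow wv wY]] := @orthonormal_extend N v (output M 0 h :: Ys) _ ov.
  rewrite /=; case: (N) N1 sY dN => // n _ sY dn.
  apply: leq_trans dn; rewrite addn1 ltnS mul2n -addnn leq_add2l.
  by rewrite (leq_ltn_trans sY).
exists w; split=> //; rewrite /run hu//.
  by apply: wY; rewrite inE eqxx.
move=> y yY l lN; have -> : l = N by apply/eqP; rewrite eqn_leq andbC.
by apply: wY; rewrite inE yY orbT.
Qed.

End Resisting.

(** * The lower bound on the risk *)

Section LowerBound.
Context {K : realType}.
Variables (N : nat) (q wx wf wg eta : K).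
Hypotheses (q0 : 0 <= q) (q1 : q < 1) (N1 : (1 <= N)%N).
Hypotheses (hwx : 0 <= wx) (hwf : 0 <= wf) (hwg : 0 <= wg).
Hypothesis hw : wx + wf + wg = 1.
Hypothesis rc : risk_coefficient N q wx wf eta.

(** The left-hand side of the initial condition for L = 1, starting at the origin, with the values
    of [minimizer_sqr] and [maxF_origin]. *)
Definition budget (gam xi : nat -> K) : K := wx * xi_sqr N xi
  + wf * (2 * (gam 0%N * xi 0%N) - gam 0%N ^+ 2 - q * xi_sqr N xi) / (1 - q)
  + wg * gam 0%N ^+ 2.

(** Only the function gap is not visibly positive: [mix_const_ge0] at k = 0 bounds the factor of w_f
    below by gamma_0 xi_0. *)
Lemma budget_gt0 (gam xi tau A : nat -> K) :
  chain N q gam xi tau A -> 0 < budget gam xi.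
Proof.
move=> ch; have qb0 : 0 < 1 - q by rewrite subr_gt0.
have := mix_const_ge0 ch (leq0n N).
rewrite big_ord0 subr0 (chain_A0 ch) !mul1r => h.
have g0 := chain_gam_gt0 ch (leq0n N); have x0 := chain_xi_gt0 ch (leq0n N).
have T0 : 0 < xi_sqr N xi.
  rewrite /xi_sqr big_ord_recl /= ltr_pwDl ?exprn_gt0//.
  by apply: sumr_ge0 => l _; exact: sqr_ge0.
have f0 : 0 < (2 * (gam 0%N * xi 0%N) - gam 0%N ^+ 2 - q * xi_sqr N xi) / (1 - q).
  rewrite divr_gt0//; have := mulr_gt0 qb0 (mulr_gt0 g0 x0).
  by lra.
rewrite /budget -mulrA; set B := _ / (1 - q) in f0 *.
have G0 : 0 < gam 0%N ^+ 2 by rewrite exprn_gt0.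
have h1 := mulr_ge0 hwx (ltW T0); have h2 := mulr_ge0 hwf (ltW f0).
have h3 := mulr_ge0 hwg (ltW G0).
have [wx0|wx0] := eqVneq wx 0; last first.
  have : 0 < wx * xi_sqr N xi by rewrite mulr_gt0// lt_neqAle eq_sym wx0.
  by lra.
have [wf0|wf0] := eqVneq wf 0; last first.
  have : 0 < wf * B by rewrite mulr_gt0// lt_neqAle eq_sym wf0.
  by lra.
by move: hw; rewrite wx0 wf0 !add0r => ->; rewrite !mul0r mul1r !add0r.
Qed.

Lemma chain_scale_mul s k : chain_scale N q wx wf eta s k = s * chain_scale N q wx wf eta 1 k.
Proof. by elim: k => [|k IH] /=; rewrite ?mulr1// IH mulrA. Qed.

Lemma budget_scale s :
  budget (opt_gam N q wx wf eta s) (opt_xi N q wx wf eta s) =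
  s ^+ 2 * budget (opt_gam N q wx wf eta 1) (opt_xi N q wx wf eta 1).
Proof.
have gs k : opt_gam N q wx wf eta s k = s * opt_gam N q wx wf eta 1 k.
  by rewrite /opt_gam chain_scale_mul; ring.
have xs k : opt_xi N q wx wf eta s k = s * opt_xi N q wx wf eta 1 k.
  by rewrite /opt_xi chain_scale_mul; ring.
rewrite /budget /xi_sqr.
have -> : \sum_(l < N.+1) opt_xi N q wx wf eta s l ^+ 2 =
    s ^+ 2 * \sum_(l < N.+1) opt_xi N q wx wf eta 1 l ^+ 2.
  by rewrite mulr_sumr; apply: eq_bigr => l _; rewrite xs exprMn.
by rewrite gs xs; ring.
Qed.

Lemma hard_instance (L R : K) (d : nat) (M : fo_method K d) :
  0 < L -> 0 < R -> (2 * N + 1 <= d)%N ->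
  exists f, instance_class (q * L) L wx wf wg R (f, 0) /\
    L / 2 * eta * R ^+ 2 <= f (run N M f 0) - fmin f.
Proof.
move=> L0 R0 dN; have qb0 : 0 < 1 - q by rewrite subr_gt0.
pose B1 := budget (opt_gam N q wx wf eta 1) (opt_xi N q wx wf eta 1).
have B10 : 0 < B1.
  exact: budget_gt0 (coefficient_chain q0 q1 N1 hwx rc ltr01).
(* The budget is homogeneous of degree 2 in the scale, so this s saturates the initial condition. *)
pose s := R / Num.sqrt B1.
have s0 : 0 < s by rewrite divr_gt0// sqrtr_gt0.
have ch := coefficient_chain q0 q1 N1 hwx rc s0.
have val := chain_value s q0 q1 N1 hwx hw rc.
have bR : budget (opt_gam N q wx wf eta s) (opt_xi N q wx wf eta s) = R ^+ 2.
  rewrite budget_scale -/B1 /s expr_div_n sqr_sqrtr ?(ltW B10)//.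
  by rewrite divfK// gt_eqF.
move: ch val bR; set gam := opt_gam _ _ _ _ _ s; set xi := opt_xi _ _ _ _ _ s.
set tau := opt_tau _ _ _ _ _ s; set A := opt_A _ _ _ _ _ => ch val bR.
pose ht i := height N q gam xi tau i.
pose pc (u : nat -> 'rV[K]_d) := piece (N := N) q gam xi tau u.
have ex (ux : (nat -> 'rV[K]_d) * 'rV[K]_d) :
    exists al, kkt_on (1 - q) (pc ux.1) ht predT ux.2 al.
  exact: (kkt_exists (pc ux.1) ht qb0 (P := predT) ux.2 (i0 := ord0) isT).
have [W WP] := choice ex.
pose W' u x := W (u, x).
have WP' u x : kkt_on (1 - q) (pc u) ht predT x (W' u x) := WP (u, x).
have [u [ou hid]] := resisting q0 q1 L0 ch N1 dN M WP'.
move: hid; set f := (X in run N M X 0) => hid.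
exists f.
have ge0 := maxF_ge0 q0 q1 ou (WP' u).
have [Fm Gm] := maxF_minimizer q1 ou (WP' u).
have [F0 G0] := maxF_origin q0 q1 ch ou (WP' u).
have am : argmin f (minimizer N xi u).
  by move=> y; rewrite /f /hard_function Fm mulr0 mulr_ge0// ltW.
have fm : fmin f = 0 by rewrite (fmin_argmin am) /f /hard_function Fm mulr0.
split.
  split; first exact: maxF_smooth q0 q1 L0 (WP' u).
  exists (minimizer N xi u) => //.
  rewrite fm subr0 sub0r !enorm_sqr dotNl dotNr opprK (minimizer_sqr xi ou).
  have [_ ->] := maxF_grad q0 q1 L0 (WP' u) 0.
  rewrite dotZl dotZr G0 -bR /budget /f /hard_function le_eqVlt; apply/orP; left; apply/eqP.
  set F00 := maxF _ _ _ _ 0 in F0 *.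
  rewrite -F0; field.
  by rewrite !gt_eqF.
rewrite fm subr0 {1}/f /hard_function.
have := maxF_hidden q0 q1 ou (WP' u) hid.
rewrite val => h.
have h2 : eta * R ^+ 2 <= 2 * maxF q (pc u) ht (W' u) (run N M f 0).
  rewrite -(ler_pM2l qb0) (mulrA (1 - q) 2) (mulrC (1 - q) 2).
  apply: (le_trans _ h); rewrite -bR /budget le_eqVlt; apply/orP; left; apply/eqP.
  by rewrite /xi_sqr; field; rewrite gt_eqF.
by have := ler_wpM2l (ltW L0) h2; lra.
Qed.

End LowerBound.

(** * The upper bound *)

Section ItemStep.
Context {K : realType} {d : nat}.
Implicit Types (Z V h X : 'rV[K]_d).

(** Here k is c / b and h, h' are gradients shifted by q (x - z). Once r^2 and a' are substituted,
    every coefficient cancels except that of |h|^2, which vanishes by the relation for c^2. *)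
Lemma item_potential_step (q a a' b k r2 : K) Z V h h' :
  r2 = b ^+ 2 + q * a ^+ 2 ->
  k ^+ 2 * b ^+ 2 = 2 * (1 - a) - q * (1 - a) ^+ 2 ->
  a' = (1 - q + q * a) * a + k * b ^+ 2 ->
  let Z' := Z - ((1 - a) + a * k) *: h in let V' := V - k *: h in
  q * dotr Z Z - 2 * dotr h (Z - a' *: V) - r2 * dotr V V
    + 2 * dotr (h - h' + q *: (Z' - Z)) (Z' - a *: V') =
  q * dotr Z' Z' - 2 * dotr h' (Z' - a *: V') - r2 * dotr V' V'.
Proof.
move=> -> e -> /=; set t := 1 - a + a * k.
have -> : Z - t *: h - Z = - t *: h by rewrite addrAC subrr add0r scaleNr.
have -> : Z - t *: h - a *: (V - k *: h) = Z - a *: V - (1 - a) *: h.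
  by apply/rowP => i; rewrite /t !mxE; ring.
rewrite scalerA !(dotBl, dotBr, dotDl, dotDr) !(dotNl, dotNr, dotZl, dotZr).
rewrite (dotC h Z) (dotC h V).
move: (dotr Z Z) (dotr V V) (dotr h h) (dotr Z h) (dotr V h)
  (dotr h' Z) (dotr h' V) (dotr h' h) => ZZ VV hh Zh Vh hZ hV hh'.
rewrite /t; apply/eqP; rewrite -subr_eq0; apply/eqP.
transitivity (hh * (k ^+ 2 * b ^+ 2 - (2 * (1 - a) - q * (1 - a) ^+ 2))).
  by ring.
by rewrite e subrr mulr0.
Qed.

(** In the first step Z and V coincide, so three coefficients remain: |X|^2 gives the formula for
    r^2, |h|^2 gives [c1_sqr], and the cross term gives [b1_c1]. *)
Lemma item_potential_start (q a b k r2 eta wx wf wg f : K) X h h' :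
  r2 = b ^+ 2 + q * a ^+ 2 -> r2 = q + eta * ((1 - q) * wx - q * wf) ->
  k ^+ 2 * b ^+ 2 = 2 * (1 - a) - q * (1 - a) ^+ 2
    - eta * wf + eta * (1 - q) * wg ->
  k * b ^+ 2 = (1 - a) + q * (1 - a) * a - eta * wf ->
  let Z' := X - ((1 - a) + a * k) *: h in let V' := X - k *: h in
  eta * wf * (2 * (1 - q) * f + dotr h h - 2 * dotr h X + q * dotr X X)
    + 2 * dotr (h - h' + q *: (Z' - X)) (Z' - a *: V') =
  eta * (1 - q) * (wx * dotr X X + 2 * wf * f + wg * dotr h h)
    + q * dotr Z' Z' - 2 * dotr h' (Z' - a *: V') - r2 * dotr V' V'.
Proof.
move=> e1 e2 e3 e4 /=; set t := 1 - a + a * k.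
have -> : X - t *: h - X = - t *: h by rewrite addrAC subrr add0r scaleNr.
have -> : X - t *: h - a *: (X - k *: h) = X - a *: X - (1 - a) *: h.
  by apply/rowP => i; rewrite /t !mxE; ring.
rewrite scalerA !(dotBl, dotBr, dotDl, dotDr) !(dotNl, dotNr, dotZl, dotZr).
rewrite (dotC h X).
move: (dotr X X) (dotr h h) (dotr X h) (dotr h' X) (dotr h' h) => XX hh Xh hX hh'.
rewrite /t.
have e5 : r2 * k ^+ 2 = 2 * (1 - a) - q * (1 - a) ^+ 2 - eta * wf
    + eta * (1 - q) * wg + q * a ^+ 2 * k ^+ 2 by rewrite e1 -e3; ring.
have e6 : r2 * k = (1 - a) + q * (1 - a) * a - eta * wf + q * a ^+ 2 * k.
  by rewrite e1 -e4; ring.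
apply/eqP; rewrite -subr_eq0; apply/eqP.
transitivity (XX * (r2 - (q + eta * ((1 - q) * wx - q * wf))) +
  hh * (r2 * k ^+ 2 - (2 * (1 - a) - q * (1 - a) ^+ 2 - eta * wf
    + eta * (1 - q) * wg + q * a ^+ 2 * k ^+ 2)) -
  2 * Xh * (r2 * k - ((1 - a) + q * (1 - a) * a - eta * wf + q * a ^+ 2 * k))).
  by ring.
by rewrite e5 e6 -e2 !subrr !mulr0 subr0 addr0.
Qed.

End ItemStep.

Section ItemGuarantee.
Context {K : realType} {d : nat}.
Variables (N : nat) (q wx wf wg eta L : K) (f : 'rV[K]_d -> K).
Hypotheses (q0 : 0 <= q) (q1 : q < 1) (N1 : (1 <= N)%N).
Hypotheses (hwx : 0 <= wx) (hw : wx + wf + wg = 1).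
Hypothesis rc : risk_coefficient N q wx wf eta.
Variables (F : 'rV[K]_d -> K) (x0 xs : 'rV[K]_d).
Local Notation G := (fun x => L^-1 *: grad f x).
Hypotheses (FG : interpolable q F G) (Gs : G xs = 0).
Local Notation r := (rcoef q wx wf eta).
Local Notation a := (pa N q r).
Local Notation b := (pb N q r).
Local Notation c := (item_c N q wx wf eta).
Local Notation it := (item_iter N q wx wf L eta f x0).
Implicit Types (x y : 'rV[K]_d).

Let ord := rc_ordered rc.
Let qb0 : 0 < 1 - q. Proof. by rewrite subr_gt0. Qed.

(* Up to the factor - 2 (1 - q), the value at xs of the gap in the interpolation
   inequality between xs and x. *)
Definition excess x : K := 2 * (1 - q) * (F x - F xs) + dotr (G x) (G x)
  - 2 * dotr (G x) (x - xs) + q * dotr (x - xs) (x - xs).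

Lemma excess_le0 x : excess x <= 0.
Proof.
have := FG xs x; rewrite Gs /excess.
have -> : xs - x = - (x - xs) by rewrite opprB.
rewrite sub0r !(dotNl, dotNr) !opprK.
by move: (dotr _ _) (dotr _ _) (dotr _ _) => u v w; lra.
Qed.

(** Interpolation between x and y, recentred at xs: the excesses absorb the function values and
    leave one inner product. *)
Lemma excess_step x y : excess y <= excess x
  + 2 * dotr ((G x - q *: (x - xs)) - (G y - q *: (y - xs))) (x - xs - G x).
Proof.
have := FG x y; rewrite /excess.
have -> : x - y = (x - xs) - (y - xs) by rewrite opprB addrA subrK.
move: (G x) (G y) (x - xs) (y - xs) => g h u v.
rewrite !(dotBl, dotBr, dotZl, dotZr) (dotC h g) ?(dotC v u).
rewrite ?(dotC u g) ?(dotC v g) ?(dotC u h) ?(dotC v h).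
by lra.
Qed.

Definition item_query (k : nat) (zv : 'rV[K]_d * 'rV[K]_d) : 'rV[K]_d :=
  zv.1 + (a k.+1 / ((1 - q) * (1 - a k.+1))) *: (zv.1 - zv.2).

(** The extrapolation weight of [item_query] is what removes z - v from z_{k+1}, so that z and v
    each move along h alone. *)
Lemma item_step_shift (k : nat) z v z' v' : (k < N)%N ->
  it k = (z, v) -> it k.+1 = (z', v') ->
  let x := item_query k (z, v) in
  let h := G x - q *: (x - z) in
  [/\ z' - xs = (z - xs)
        - ((1 - a k.+1) + a k.+1 * (c k.+1 / b k.+1)) *: h,
      v' - xs = (v - xs) - (c k.+1 / b k.+1) *: h &
      (1 - a k.+1) *: (x - xs - G x) = (z' - xs) - a k.+1 *: (v' - xs)].
Proof.
move=> kN ek; rewrite [it k.+1]/= ek /= => -[<- <-].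
rewrite -/(item_query k (z, v)); set x := item_query k (z, v).
have hx : x - (x - L^-1 *: grad f x) = L^-1 *: grad f x by rewrite opprB addrC subrK.
have a1 : 1 - a k.+1 != 0 by rewrite subr_eq0 eq_sym lt_eqF// (pa_lt1 ord).
have qn : 1 - q != 0 by rewrite gt_eqF.
rewrite hx; set g := L^-1 *: grad f x; set k' := c k.+1 / b k.+1.
split.
- apply/rowP => i; have xi : x ord0 i = z ord0 i +
    a k.+1 / ((1 - q) * (1 - a k.+1)) * (z ord0 i - v ord0 i) by rewrite !mxE.
  clearbody x g k'; rewrite !mxE xi.
  by move: (a _) a1 => u u1; field; rewrite u1 qn.
- by rewrite addrAC.
- by apply/rowP => i; clearbody x g k'; rewrite !mxE; ring.
Qed.

Definition item_budget : K := wx * dotr (x0 - xs) (x0 - xs)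
  + 2 * wf * (F x0 - F xs) + wg * dotr (G x0) (G x0).

(* Consecutive queries enter with multiplier 1 - a_{k+1}, the pair (xs, x_k) with
   a_k - a_{k+1}; the quadratic terms then telescope exactly. *)
Lemma item_potential k y : (1 <= k <= N)%N ->
  let: (z, v) := it k in
  (1 - a k) * excess y <= eta * (1 - q) * item_budget
    + q * dotr (z - xs) (z - xs)
    - 2 * dotr (G y - q *: (y - z)) ((z - xs) - a k *: (v - xs))
    - r ^+ 2 * dotr (v - xs) (v - xs).
Proof.
have hE z y' : G y' - q *: (y' - xs) = (G y' - q *: (y' - z)) - q *: (z - xs).
  by apply/rowP => i; rewrite !mxE; ring.
have key k' x y' z z' w : (1 - a k'.+1) *: (x - xs - G x) = w ->
    2 * dotr (G x - q *: (x - z) - (G y' - q *: (y' - z')) + q *: (z' - xs - (z - xs))) w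
    = (1 - a k'.+1) * (2 * dotr ((G x - q *: (x - xs)) - (G y' - q *: (y' - xs)))
      (x - xs - G x)).
  move=> <-; rewrite dotZr (hE z x) (hE z' y').
  rewrite (_ : G x - q *: (x - z) - q *: (z - xs) - _ =
    G x - q *: (x - z) - (G y' - q *: (y' - z')) + q *: (z' - xs - (z - xs))).
    by ring.
  by apply/rowP => i; rewrite !mxE; ring.
case: k => // k; elim: k y => [y _|k IH y].
  have xq : item_query 0 (x0, x0) = x0.
    by rewrite /item_query subrr scaler0 addr0.
  case E1 : (it 1%N) => [z' v'].
  have := item_step_shift N1 erefl E1; rewrite xq => -[ez ev ex].
  have bn : b 1%N != 0 by rewrite gt_eqF// (rc_b1 rc).
  have e1 : r ^+ 2 = b 1%N ^+ 2 + q * a 1%N ^+ 2.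
    by rewrite (pbE q0 q1 ord) ?N1//; ring.
  have e3 : (c 1%N / b 1%N) ^+ 2 * b 1%N ^+ 2 = 2 * (1 - a 1%N)
      - q * (1 - a 1%N) ^+ 2 - eta * wf + eta * (1 - q) * wg.
    by rewrite -(c1_sqr q0 q1 N1 hw rc) -exprMn divfK.
  have e4 : c 1%N / b 1%N * b 1%N ^+ 2 = (1 - a 1%N)
      + q * (1 - a 1%N) * a 1%N - eta * wf.
    by rewrite -(b1_c1 q0 q1 N1 rc) expr2 mulrA divfK// mulrC.
  have := @item_potential_start K d q (a 1%N) (b 1%N) (c 1%N / b 1%N) (r ^+ 2)
    eta wx wf wg (F x0 - F xs) (x0 - xs) (G x0 - q *: (x0 - x0))
    (G y - q *: (y - z')) e1 (rc_sqr rc) e3 e4.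
  rewrite /= -ez -ev (key 0%N x0 y x0 z' _ ex).
  (* The multiplier a_0 - a_1 of the pair (xs, x_0), with the formal a_0 = 1 - eta w_f; the risk
     equation makes it nonnegative. *)
  have mu0 : 0 <= 1 - a 1%N - eta * wf.
    have [_ _ _ <-] := rc; set B := Num.sqrt _ * _.
    have : 0 <= B by rewrite mulr_ge0 ?sqrtr_ge0// ltW// (rc_b1 rc).
    have := mulr_ge0 (ltW (rc_eta_gt0 rc)) hwx.
    by lra.
  have h1 := mulr_ge0_le0 mu0 (excess_le0 x0).
  have a1 : 0 <= 1 - a 1%N by rewrite subr_ge0 ltW// (pa_lt1 ord)// N1.
  have h2 := ler_wpM2l a1 (excess_step x0 y).
  rewrite subrr scaler0 subr0 => h3.
  move: h1 h2 h3; rewrite /item_budget.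
  set E := excess y; set D := dotr _ (x0 - xs - _).
  set V := dotr (v' - xs) _; set Z := dotr (z' - xs) _.
  set H := dotr (G y - _) _; rewrite /excess.
  move: (dotr (G x0) _) (dotr (G x0) _) (dotr (x0 - xs) _) => gg gx xx.
  clearbody E D V Z H; lra.
move=> /andP[_ kN]; have {}IH x := IH x (ltnW kN).
case E1 : (it k.+1) IH => [z v] IH; case E2 : (it k.+2) => [z' v'].
have := item_step_shift kN E1 E2.
set x := item_query k.+1 (z, v) => -[ez ev ex].
have h : (1 <= k.+2 <= N)%N by [].
have bn : b k.+2 != 0 by rewrite gt_eqF// (pb_gt0 q0 q1 ord).
have e1 : r ^+ 2 = b k.+2 ^+ 2 + q * a k.+2 ^+ 2 by rewrite (pbE q0 q1 ord h); ring.
have e2 : (c k.+2 / b k.+2) ^+ 2 * b k.+2 ^+ 2 =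
    2 * (1 - a k.+2) - q * (1 - a k.+2) ^+ 2.
  by rewrite -exprMn divfK// item_cE// (pcE q0 q1 ord h).
have e3 : a k.+1 = (1 - q + q * a k.+2) * a k.+2 + c k.+2 / b k.+2 * b k.+2 ^+ 2.
  have [-> _] := paired_step q r kN.
  by rewrite item_cE//; congr (_ + _); rewrite expr2 mulrA divfK.
have := @item_potential_step K d q (a k.+2) (a k.+1) (b k.+2) (c k.+2 / b k.+2)
  (r ^+ 2) (z - xs) (v - xs) (G x - q *: (x - z)) (G y - q *: (y - z')) e1 e2 e3.
rewrite /= -ez -ev (key k.+1 x y z z' _ ex) => id.
have a1 : 0 <= 1 - a k.+2 by rewrite subr_ge0 ltW// (pa_lt1 ord).
have aa : 0 <= a k.+1 - a k.+2.
  by rewrite subr_ge0 (pa_le ord)// leqnSn.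
have h2 := ler_wpM2l a1 (excess_step x y).
have h1 := mulr_ge0_le0 aa (excess_le0 x).
have h3 := IH x.
clear ez ev ex.
move: h1 h2 h3 id; set D := dotr _ (x - xs - _).
set V := dotr (v - xs) _; set Z := dotr (z - xs) _.
set V' := dotr (v' - xs) _; set Z' := dotr (z' - xs) _.
set H := dotr (G x - _) (_ - a k.+1 *: _); set H' := dotr (G y - _) _.
set E := excess x; set E' := excess y.
by clearbody D V Z V' Z' H H' E E'; lra.
Qed.

Lemma item_guarantee :
  2 * (F (item_output N q wx wf L eta f x0) - F xs) <= eta * item_budget.
Proof.
have := @item_potential N (it N).1; rewrite N1 leqnn => /(_ isT).
rewrite /item_output; case: (it N) => z v /=.
rewrite subrr scaler0 subr0 pa_last => h; rewrite -(ler_pM2l qb0).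
(* The pair (xs, z_N) enters with multiplier a_N = r, which completes the weight 1 - r of the
   potential to 1. *)
have := mulr_ge0_le0 (ltW (rc_r_gt0 rc)) (excess_le0 z).
have := dot_ge0 (L^-1 *: grad f z - r *: (v - xs)).
move: h; rewrite /excess.
move: (L^-1 *: _) (z - xs) (v - xs) => g u w.
rewrite !(dotBl g, dotBr, dotZl, dotZr) (dotC w g).
by lra.
Qed.

End ItemGuarantee.

(** * ITEM-w as a first-order method, and the value of the risk *)

Section ItemMethod.
Context {K : realType} {d : nat}.
Variables (N : nat) (q wx wf eta L : K).

Definition answered_step (k : nat) (zv : 'rV[K]_d * 'rV[K]_d) (g : 'rV[K]_d) :
    'rV[K]_d * 'rV[K]_d :=
  let a := pa N q (rcoef q wx wf eta) k.+1 in
  let b := pb N q (rcoef q wx wf eta) k.+1 in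
  let c := item_c N q wx wf eta k.+1 in
  let x := item_query N q wx wf eta k zv in
  let xp := x - L^-1 *: g in
  let h := x - xp - q *: (x - zv.1) in
  let v' := zv.2 - (c / b) *: h in
  ((1 - a) *: xp + a *: v', v').

Lemma item_step_answered f k zv : item_step N q wx wf L eta f k zv =
  answered_step k zv (grad f (item_query N q wx wf eta k zv)).
Proof. by case: zv. Qed.

(** A method keeps no memory, so the state is replayed from the past gradients, with the step index
    carried along. *)
Definition item_state (x0 : 'rV[K]_d) (h : seq (K * 'rV[K]_d)) :=
  foldl (fun s ans => (s.1.+1, answered_step s.1 s.2 ans.2)) (0%N, (x0, x0)) h.

Definition item_method : fo_method K d := FOMethod
  (fun x0 h => Some (item_query N q wx wf eta (size h) (item_state x0 h).2))
  (fun x0 h => (item_state x0 h).2.1).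

Lemma item_run f x0 : run N item_method f x0 = item_output N q wx wf L eta f x0.
Proof.
pose it := item_iter N q wx wf L eta f x0.
suff H k : let h := iter k (ask item_method f x0) [::] in
    size h = k /\ item_state x0 h = (k, it k).
  by rewrite /run /item_output /=; have [_ ->] := H N.
elim: k => [//|k [sk ek]]; rewrite iterS.
move: sk ek; set h := iter k _ _; clearbody h => sk ek.
have -> : ask item_method f x0 h =
    rcons h (oracle f (item_query N q wx wf eta k (it k))).
  (* The imposed first query x_0 agrees with [item_query] because z_0 = v_{-1}. *)
  move: sk ek; case: h => [<- _|p h sk ek] /=.
    by rewrite /item_query subrr scaler0 addr0.
  by rewrite -[p :: h]/(p :: h) ek -sk.
split; first by rewrite size_rcons sk.
by rewrite /item_state foldl_rcons -/(item_state x0 h) ek /it /= item_step_answered.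
Qed.

End ItemMethod.

Section Risk.
Context {K : realType}.
Variables (L mu : K) (N : nat) (wx wf wg eta : K).
Hypotheses (L0 : 0 < L) (muL : 0 <= mu < L) (N1 : (1 <= N)%N).
Hypotheses (hwx : 0 <= wx) (hwf : 0 <= wf) (hwg : 0 <= wg).
Hypothesis hw : wx + wf + wg = 1.
Hypothesis rc : risk_coefficient N (mu / L) wx wf eta.

Let q0 : 0 <= mu / L.
Proof. by have /andP[h _] := muL; rewrite divr_ge0// ltW. Qed.

Let q1 : mu / L < 1.
Proof. by have /andP[_ h] := muL; rewrite ltr_pdivrMr// mul1r. Qed.

Lemma item_bound (d : nat) (R : K) (f : 'rV[K]_d -> K) x0 :
  instance_class mu L wx wf wg R (f, x0) ->
  f (item_output N (mu / L) wx wf L eta f x0) - fmin f <= L / 2 * eta * R ^+ 2.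
Proof.
move=> [sf [xs am]]; rewrite (fmin_argmin am) !enorm_sqr => bR.
have FG := smooth_interpolable L0 muL sf.
have Gs : L^-1 *: grad f xs = 0 by rewrite (grad_argmin L0 sf am) scaler0.
have := item_guarantee q0 q1 N1 hwx hw rc x0 FG Gs.
rewrite /item_budget; set y := item_output _ _ _ _ _ _ _ _ => h.
have h2 : 2 * (L^-1 * f y - L^-1 * f xs) <= eta * R ^+ 2.
  apply: (le_trans h); rewrite ler_pM2l ?(rc_eta_gt0 rc)//.
  apply: le_trans bR; rewrite dotZl dotZr le_eqVlt; apply/orP; left; apply/eqP.
  by field; rewrite gt_eqF.
have := ler_wpM2l (ltW L0) h2.
have -> : L * (2 * (L^-1 * f y - L^-1 * f xs)) = 2 * (f y - f xs).
  by field; rewrite gt_eqF.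
by lra.
Qed.

Lemma minimax_riskE (R : K) (d : nat) : 0 < R -> (2 * N + 1 <= d)%N ->
  minimax_risk N (@instance_class K d mu L wx wf wg R) = (L / 2 * eta * R ^+ 2)%:E.
Proof.
move=> R0 dN; apply/eqP; rewrite eq_le; apply/andP; split.
  apply: (@le_trans _ _ (ereal_sup [set (p.1 (run N
      (item_method N (mu / L) wx wf eta L) p.1 p.2) - fmin p.1)%:E
      | p in @instance_class K d mu L wx wf wg R])).
    by apply: ereal_inf_lbound; exists (item_method N (mu / L) wx wf eta L).
  apply: ge_ereal_sup => _ [[f x0] fx <-]; rewrite lee_fin.
  by have := item_bound fx; rewrite -item_run.
apply: le_ereal_inf_tmp => _ [M _ <-].
have [f [fi fM]] := hard_instance q0 q1 N1 hwx hwf hwg hw rc M L0 R0 dN.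
rewrite divfK ?gt_eqF// in fi.
apply: (@le_trans _ _ (f (run N M f 0) - fmin f)%:E); first by rewrite lee_fin.
by apply: ereal_sup_ubound; exists (f, 0).
Qed.

End Risk.

(** * Existence of the risk coefficient *)

(* Weak form of [ordered], stable under limits in r. *)
Definition weakly_ordered (K : realType) (N : nat) (q r : K) : Prop :=
  forall k, (1 <= k <= N)%N -> pa N q r k <= 1 /\ 0 <= pb N q r k.

Section WeaklyOrdered.
Context {K : realType}.
Variables (N : nat) (q r : K).
Hypotheses (q0 : 0 <= q) (q1 : q < 1) (N1 : (1 <= N)%N) (r0 : 0 <= r).
Hypothesis wo : weakly_ordered N q r.
Local Notation a := (pa N q r).
Local Notation b := (pb N q r).
Local Notation c := (pc N q r).

(** For q > 0 the step preserves q a^2 + b^2 and does not raise b, so it does not lower a; for q = 0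
    it simply adds c b to a. *)
Lemma weak_step k : (1 <= k < N)%N -> r <= a k.+1 ->
  [/\ a k.+1 <= a k & 0 < a k.+1 < 1 -> 0 < b k -> 0 < b k.+1 -> a k.+1 < a k].
Proof.
move=> /andP[k1 kN] ra.
have h1 : (1 <= k.+1 <= N)%N by [].
have [a1 b0] := wo h1.
have [_] : a k <= 1 /\ 0 <= b k by apply: wo; rewrite k1 ltnW.
have a0 := le_trans r0 ra.
have c2 : c k.+1 ^+ 2 = 2 * (1 - a k.+1) - q * (1 - a k.+1) ^+ 2.
  by apply/pc_sqr/radicand_ge0 => //; rewrite a0.
have cp : 0 < a k.+1 < 1 -> 0 < c k.+1.
  by move=> /andP[_ h]; rewrite sqrtr_gt0 radicand_gt0// a0.
have c0 := pc_ge0 N q r k.+1.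
have [-> ->] := paired_step q r kN.
move: a1 b0 a0 c2 cp c0; move: (a _) (b _) (c _) => x y z x1 y0 x0 z2 zp z0 y'0.
have d0 : 0 < 1 - q + q * x by rewrite ltr_wpDr ?mulr_ge0 ?subr_gt0.
set x' := (1 - q + q * x) * x + z * y.
set y' := - q * z * x + (1 - q + q * x) * y in y'0 *.
have x'0 : 0 <= x' by rewrite addr_ge0 ?mulr_ge0 ?(ltW d0).
have cons : y' ^+ 2 + q * x' ^+ 2 = y ^+ 2 + q * x ^+ 2.
  have e : (1 - q + q * x) ^+ 2 + q * z ^+ 2 = 1 by rewrite z2; ring.
  by rewrite -[RHS]mul1r -{1}e /x' /y'; ring.
have [qe|qn] := eqVneq q 0.
  have e : x' = x + z * y by rewrite /x' qe; ring.
  rewrite e lerDl mulr_ge0//; split=> // h _ yp.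
  by rewrite ltrDl mulr_gt0// zp.
have qp : 0 < q by rewrite lt_neqAle eq_sym qn.
have d1 : y' <= y - q * z * x.
  have : 0 <= q * (1 - x) * y by rewrite !mulr_ge0 ?subr_ge0.
  by rewrite /y'; lra.
have qzx : 0 <= q * z * x by rewrite !mulr_ge0.
have yy : y' ^+ 2 <= y ^+ 2.
  by rewrite ler_sqr ?nnegrE//; apply: (le_trans d1); rewrite gerBl.
split.
  by rewrite -ler_sqr ?nnegrE// -(ler_pM2l qp); lra.
move=> h y'p yp; have /andP[xp _] := h.
have yy' : y' ^+ 2 < y ^+ 2.
  rewrite ltr_sqr ?nnegrE//; apply: (le_lt_trans d1).
  by rewrite gtrBl !mulr_gt0// zp.
by rewrite -ltr_sqr ?nnegrE// -(ltr_pM2l qp); lra.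
Qed.

Lemma weak_ge_r k : (1 <= k <= N)%N -> r <= a k.
Proof.
move=> /andP[k1 kN]; move: k kN k1.
apply: down_ind => [_|k kN IH k1]; first by rewrite pa_last.
have h := IH isT; apply: (le_trans h).
by have [|//] := weak_step (k := k) _ h; rewrite k1.
Qed.

Lemma weak_le k : (1 <= k < N)%N -> a k.+1 <= a k.
Proof.
move=> h; have /andP[k1 kN] := h.
by have [|//] := weak_step h; apply: weak_ge_r.
Qed.

Lemma weak_lt k : (1 <= k < N)%N -> 0 < a k.+1 < 1 -> 0 < b k -> 0 < b k.+1 ->
  a k.+1 < a k.
Proof.
move=> h; have /andP[k1 kN] := h.
by have [|_] := weak_step h; first by apply: weak_ge_r.
Qed.

Lemma weak_le1 k : (1 <= k <= N)%N -> a k <= a 1%N.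
Proof.
case: k => // k; elim: k => [//|k IH /= kN].
by apply: le_trans (IH (ltnW kN)); apply: weak_le.
Qed.

Lemma weak_pb_sqr k : (1 <= k <= N)%N -> b k ^+ 2 = r ^+ 2 - q * a k ^+ 2.
Proof.
move=> /andP[k1 kN]; apply: pb_sqr => // j /andP[kj jN].
have h : (1 <= j <= N)%N by rewrite jN (leq_trans k1)// ltnW.
have [h1 _] := wo h; apply: radicand_ge0 => //.
by rewrite h1 andbT (le_trans r0)// weak_ge_r.
Qed.

(** Monotonicity brings every condition back to index 1: a_k <= a_1 < 1 and b_k^2 = r^2 - q a_k^2 >=
    b_1^2. *)
Lemma weak_ordered : 0 < r -> a 1%N < 1 -> 0 < b 1%N -> ordered N q r.
Proof.
move=> rp a1 b1.
have an k : (1 <= k <= N)%N -> 0 < a k < 1.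
  move=> h; rewrite (lt_le_trans rp (weak_ge_r h)) /=.
  exact: le_lt_trans (weak_le1 h) a1.
have bn k : (1 <= k <= N)%N -> 0 < b k.
  move=> h; have [_ b0] := wo h; rewrite lt_neqAle b0 andbT eq_sym.
  have a0 : 0 <= a k by have /andP[/ltW] := an k h.
  suff : 0 < b k ^+ 2 by apply: contraTN => /eqP ->; rewrite expr0n ltxx.
  rewrite weak_pb_sqr//.
  have : 0 < b 1%N ^+ 2 by rewrite exprn_gt0.
  rewrite weak_pb_sqr ?N1// => b1s; apply: (lt_le_trans b1s).
  rewrite lerD2l lerN2 ler_wpM2l// ler_sqr ?nnegrE ?weak_le1//.
  by rewrite (le_trans a0)// weak_le1.
split=> //.
- move=> k /andP[k2 kN]; apply: radicand_ge0 => //.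
  have /andP[/ltW -> /ltW ->//] : 0 < a k < 1.
  by apply: an; rewrite kN andbT ltnW.
- move=> k h; have /andP[k1 kN] := h.
  by apply: weak_lt => //; [apply: an | apply: bn; rewrite k1 ltnW | apply: bn].
- by rewrite pa_last.
Qed.

End WeaklyOrdered.

Section Threshold.
Context {K : realType}.
Variables (N : nat) (q : K).
Hypotheses (q0 : 0 <= q) (q1 : q < 1) (N1 : (1 <= N)%N).

Lemma pb_q0 r k : q = 0 -> (k <= N)%N -> pb N q r k = r.
Proof.
move=> qe; move: k; apply: down_ind => [|k kN IH].
  by rewrite pb_last qe subr0 sqrtr1 mul1r.
by have [_ ->] := paired_step q r kN; rewrite IH qe; ring.
Qed.

(* The start of the continuation: eta = 0, that is, r = sqrt q. *)
Lemma start_ordered k : (k <= N)%N ->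
  0 <= pa N q (Num.sqrt q) k < 1 /\ (q = 0 \/ 0 < pb N q (Num.sqrt q) k).
Proof.
set r := Num.sqrt q.
have r2 : r ^+ 2 = q by rewrite sqr_sqrtr.
have r0 : 0 <= r by exact: sqrtr_ge0.
have r1 : r < 1 by rewrite -ltr_sqr ?nnegrE// r2 expr1n.
move=> kN; suff [h1 h2 _] : [/\ 0 <= pa N q r k < 1, q = 0 \/ 0 < pb N q r k &
    pb N q r k ^+ 2 = q - q * pa N q r k ^+ 2] by [].
move: k kN; apply: down_ind => [|k kN].
  rewrite pa_last pb_last r0 r1; split=> //; last first.
    by rewrite exprMn sqr_sqrtr ?subr_ge0 ?(ltW q1)// r2; ring.
  have [|qn] := eqVneq q 0; [by left | right].
  by rewrite mulr_gt0 ?sqrtr_gt0 ?subr_gt0// lt_neqAle eq_sym qn.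
move=> [/andP[a0 a1] h b2].
have c2 : pc N q r k.+1 ^+ 2 =
    2 * (1 - pa N q r k.+1) - q * (1 - pa N q r k.+1) ^+ 2.
  by apply/pc_sqr/radicand_ge0 => //; rewrite a0 ltW.
have c0 := pc_ge0 N q r k.+1.
have [-> ->] := paired_step q r kN.
have [qe|qn] := eqVneq q 0.
  have rz : r = 0 by rewrite /r qe sqrtr0.
  have bz : pb N q r k.+1 = 0.
    by apply/eqP; rewrite -[_ == 0](expf_eq0 _ 2) b2 qe !mul0r subr0.
  rewrite bz; move: a0 a1; move: (pa _ _ _ _) (pc _ _ _ _) => x z x0 x1.
  by rewrite qe; split; [|by left|ring]; rewrite mulr0 !mul0r subr0 !addr0 mul1r x0.
case: h => [qe|]; first by move: qn; rewrite qe eqxx.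
move: a0 a1 b2 c2 c0; move: (pa _ _ _ _) (pb _ _ _ _) (pc _ _ _ _).
move=> x y z x0 x1 y2 z2 z0 y0.
have qp : 0 < q by rewrite lt_neqAle eq_sym qn.
have d0 : 0 < 1 - q + q * x by rewrite ltr_wpDr ?mulr_ge0 ?subr_gt0.
have xd : x < 1 - q + q * x.
  have : 0 < (1 - q) * (1 - x) by rewrite mulr_gt0 ?subr_gt0.
  by lra.
set x' := (1 - q + q * x) * x + z * y.
set y' := - q * z * x + (1 - q + q * x) * y.
have x'0 : 0 <= x' by rewrite addr_ge0 ?mulr_ge0 ?(ltW d0) ?(ltW y0).
have cons : y' ^+ 2 = q - q * x' ^+ 2.
  have e : (1 - q + q * x) ^+ 2 + q * z ^+ 2 = 1 by rewrite z2; ring.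
  have -> : q = y ^+ 2 + q * x ^+ 2 by rewrite y2; ring.
  have : y' ^+ 2 + q * x' ^+ 2 = y ^+ 2 + q * x ^+ 2.
    by rewrite -[RHS]mul1r -{1}e /x' /y'; ring.
  have -> : y ^+ 2 + q * x ^+ 2 = q by rewrite y2; ring.
  by move=> e2; lra.
(* Comparing squares reduces this to x < 1 - q + q x. Then x' < 1 follows, since the conserved
   quantity is q here: q x'^2 = q - y'^2. *)
have y'0 : 0 < y'.
  rewrite /y' addrC mulNr mulNr subr_gt0 -ltr_sqr ?nnegrE ?mulr_ge0 ?(ltW d0) ?(ltW y0)//.
  rewrite !exprMn y2 z2 -subr_gt0.
  have -> : (1 - q + q * x) ^+ 2 * (q - q * x ^+ 2)
    - q ^+ 2 * (2 * (1 - x) - q * (1 - x) ^+ 2) * x ^+ 2 =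
    q * ((1 - q + q * x) ^+ 2 - x ^+ 2) by ring.
  by rewrite mulr_gt0// subr_gt0 ltr_sqr ?nnegrE ?(ltW d0).
split=> //; last by right.
rewrite x'0 /= -ltr_sqr ?nnegrE// expr1n -(ltr_pM2l qp).
have : 0 < y' ^+ 2 by rewrite exprn_gt0.
by lra.
Qed.

Lemma continuousDf (f g : K -> K) : continuous f -> continuous g ->
  continuous (fun x => f x + g x).
Proof. by move=> cf cg x; apply: (@cvgD K K^o); [exact: cf | exact: cg]. Qed.

Lemma continuousMf (f g : K -> K) : continuous f -> continuous g ->
  continuous (fun x => f x * g x).
Proof. by move=> cf cg x; apply: cvgM; [exact: cf | exact: cg]. Qed.

Lemma continuous_cst (k : K) : continuous (fun _ : K => k).
Proof. by move=> x; exact: cvg_cst. Qed.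

Lemma continuous_sqrt (f : K -> K) : continuous f ->
  continuous (fun x => Num.sqrt (f x)).
Proof.
by move=> cf x; apply: continuous_comp; [exact: cf | exact: sqrt_continuous].
Qed.

(** Continuity holds for every r, even where the sequence is not well defined, since [Num.sqrt] is
    continuous and 0 on negative numbers. *)
Lemma paired_continuous k : (k <= N)%N ->
  continuous (fun r => pa N q r k) /\ continuous (fun r => pb N q r k).
Proof.
move: k; apply: down_ind => [|k kN [ca cb]].
  have -> : (fun r => pa N q r N) = id by apply/funext => r; rewrite pa_last.
  have -> : (fun r => pb N q r N) = (fun r => Num.sqrt (1 - q) * r).
    by apply/funext => r; rewrite pb_last.
  have ci : continuous (id : K -> K) by move=> r; exact: cvg_id.
  by split=> //; exact: continuousMf (@continuous_cst _) ci.
have cd : continuous (fun r => (1 - q) + q * pa N q r k.+1).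
  exact: continuousDf (@continuous_cst _) (continuousMf (@continuous_cst _) ca).
have cc : continuous (fun r => pc N q r k.+1).
  rewrite /pc /radicand; apply: continuous_sqrt; apply: continuousMf.
    have -> : (fun r => 1 - pa N q r k.+1) = (fun r => 1 + (-1) * pa N q r k.+1).
      by apply/funext => r; rewrite mulN1r.
    exact: continuousDf (@continuous_cst _) (continuousMf (@continuous_cst _) ca).
  exact: continuousDf (@continuous_cst _) (continuousMf (@continuous_cst _) ca).
have -> : (fun r => pa N q r k) = (fun r =>
    ((1 - q) + q * pa N q r k.+1) * pa N q r k.+1 + pc N q r k.+1 * pb N q r k.+1).
  by apply/funext => r; have [-> _] := paired_step q r kN.
have -> : (fun r => pb N q r k) = (fun r => - q * pc N q r k.+1 * pa N q r k.+1
    + ((1 - q) + q * pa N q r k.+1) * pb N q r k.+1).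
  by apply/funext => r; have [_ ->] := paired_step q r kN.
split; first exact: continuousDf (continuousMf cd ca) (continuousMf cc cb).
exact: continuousDf (continuousMf (continuousMf (@continuous_cst _) cc) ca)
  (continuousMf cd cb).
Qed.

End Threshold.

Section Existence.
Context {K : realType}.
Variables (N : nat) (q wx wf : K).
Hypotheses (q0 : 0 <= q) (q1 : q < 1) (N1 : (1 <= N)%N).
Hypotheses (hwx : 0 <= wx) (hwf : 0 <= wf) (hqw : 0 < q \/ 0 < wx).
Local Notation r := (rcoef q wx wf).
Local Notation a x k := (pa N q (r x) k).
Local Notation b x k := (pb N q (r x) k).

Definition defect (x : K) : K :=
  a x 1 + x * (wx + wf) + Num.sqrt (x / (1 - q)) * b x 1 - 1.

(** An open condition satisfied at 0. For q = 0 the start is r = 0, where all b_k vanish; hence the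
    alternative, under which b_k is r throughout. *)
Definition feasible (x : K) : Prop := defect x < 0 /\
  forall k, (1 <= k <= N)%N -> a x k < 1 /\ (q = 0 \/ 0 < b x k).

Let r0 x : 0 <= r x. Proof. exact: sqrtr_ge0. Qed.

Lemma rcoef_continuous : continuous r.
Proof.
apply: continuous_sqrt; apply: continuousDf (@continuous_cst _ _) _.
by apply: continuousMf (@continuous_cst _ _) => x; exact: cvg_id.
Qed.

Lemma a_continuous k : (k <= N)%N -> continuous (fun x => a x k).
Proof.
move=> kN x; apply: (@continuous_comp _ _ _ r (fun r => pa N q r k)).
  exact: rcoef_continuous.
exact: (proj1 (paired_continuous q kN)).
Qed.

Lemma b_continuous k : (k <= N)%N -> continuous (fun x => b x k).
Proof.
move=> kN x; apply: (@continuous_comp _ _ _ r (fun r => pb N q r k)).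
  exact: rcoef_continuous.
exact: (proj2 (paired_continuous q kN)).
Qed.

Lemma defect_continuous : continuous defect.
Proof.
have ci : continuous (id : K -> K) by move=> x; exact: cvg_id.
apply: continuousDf (@continuous_cst _ _); apply: continuousDf.
  apply: continuousDf; first exact: a_continuous.
  exact: continuousMf ci (@continuous_cst _ _).
apply: continuousMf; last exact: b_continuous.
exact: continuous_sqrt (continuousMf ci (@continuous_cst _ _)).
Qed.

Lemma feasible_weak x : feasible x -> weakly_ordered N q (r x).
Proof.
move=> [_ h] k kN; have [h1 h2] := h k kN; split; first exact: ltW.
case: h2 => [qe|/ltW//]; rewrite (pb_q0 _ qe)//.
by have /andP[] := kN.
Qed.

(** [rsq] equals q - q x (w_x + w_f) + x w_x, and a nonpositive defect bounds x (w_x + w_f) by 1 -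
    a_1. *)
Lemma rsq_lower x : 0 <= x -> weakly_ordered N q (r x) -> defect x <= 0 ->
  q * a x 1 + x * wx <= rsq q wx wf x.
Proof.
move=> x0 wo; rewrite /defect /rsq => dx.
have [_ b0] := wo 1%N N1.
have : 0 <= Num.sqrt (x / (1 - q)) * b x 1 by rewrite mulr_ge0 ?sqrtr_ge0.
move=> h; have : x * (wx + wf) <= 1 - a x 1 by lra.
by move/(ler_wpM2l q0); lra.
Qed.

Lemma rcoef_sqr x : 0 <= x -> weakly_ordered N q (r x) -> defect x <= 0 ->
  r x ^+ 2 = rsq q wx wf x.
Proof.
move=> x0 wo dx; rewrite sqr_sqrtr//; apply: le_trans (rsq_lower x0 wo dx).
have a0 : 0 <= a x 1 := le_trans (r0 x) (weak_ge_r q0 q1 (r0 x) wo (k := 1%N) N1).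
by rewrite addr_ge0 ?mulr_ge0.
Qed.

(* A uniform lower bound, which keeps r away from 0 up to the limit. *)
Lemma feasible_r_ge x : 0 <= x -> feasible x -> q <= r x.
Proof.
move=> x0 fx; have [qe|qn] := eqVneq q 0; first by rewrite {1}qe.
have wo := feasible_weak fx; have [/ltW dx h] := fx.
have rp : 0 < r x.
  have [_ [qe|]] := h N (introT andP (conj N1 (leqnn N))).
    by move: qn; rewrite qe eqxx.
  by rewrite pb_last pmulr_rgt0// sqrtr_gt0 subr_gt0.
rewrite -(ler_pM2r rp) -expr2 (rcoef_sqr x0 wo dx).
apply: le_trans (rsq_lower x0 wo dx).
have h1 := ler_wpM2l q0 (weak_ge_r q0 q1 (r0 x) wo (k := 1%N) N1).
by apply: (le_trans h1); rewrite lerDl mulr_ge0.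
Qed.

Lemma r_at0 x : x * wx = 0 -> x * wf = 0 -> r x = Num.sqrt q.
Proof.
move=> h1 h2; rewrite /rcoef; congr Num.sqrt; rewrite /rsq.
have -> : q + x * ((1 - q) * wx - q * wf) = q + (1 - q) * (x * wx) - q * (x * wf).
  by ring.
by rewrite h1 h2 !mulr0 addr0 subr0.
Qed.

Lemma feasible0 : feasible 0.
Proof.
have e := r_at0 (mul0r wx) (mul0r wf); split; last first.
  move=> k /andP[_ kN]; rewrite e.
  by have [/andP[_ h1] h2] := start_ordered q0 q1 kN.
rewrite /defect !mul0r sqrtr0 mul0r !addr0 e subr_lt0.
by have [/andP[]] := start_ordered q0 q1 N1.
Qed.

Lemma infeasible_point : exists2 x, 0 <= x & ~ feasible x.
Proof.
have m0 : 0 <= wx + wf by rewrite addr_ge0.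
have qb0 : 0 < 1 - q by rewrite subr_gt0.
have a0 x : feasible x -> 0 <= a x 1.
  by move=> fx; apply: le_trans (weak_ge_r q0 q1 (r0 x) (feasible_weak fx) (k := 1%N) N1).
have [mz|mn] := eqVneq (wx + wf) 0; last first.
  (* At this point x (w_x + w_f) = 1, so the defect is nonnegative as soon as a_1 and b_1 are. *)
  exists (wx + wf)^-1; first by rewrite invr_ge0.
  move=> fx; have [dx _] := fx; move: dx; rewrite /defect mulVf//.
  have [_ b0] := feasible_weak fx (k := 1%N) N1.
  have h := mulr_ge0 (sqrtr_ge0 ((wx + wf)^-1 / (1 - q))) b0.
  have := a0 _ fx => h2 h3.
  have : 0 < 0 :> K by lra.
  by rewrite ltxx.
have [wx0 wf0] : wx = 0 /\ wf = 0.
  by move/eqP: mz; rewrite paddr_eq0// => /andP[/eqP-> /eqP->].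
have qp : 0 < q by case: hqw => //; rewrite wx0 ltxx.
have e x : r x = Num.sqrt q by rewrite r_at0// ?wx0 ?wf0 mulr0.
pose B := pb N q (Num.sqrt q) 1.
have B0 : 0 < B.
  by have [_ [qe|//]] := start_ordered q0 q1 N1; rewrite qe ltxx in qp.
(* With w_x = w_f = 0, r stays equal to sqrt q; this x makes sqrt(x / (1 - q)) b_1 = 1. *)
exists ((1 - q) / B ^+ 2); first by rewrite divr_ge0 ?sqr_ge0 ?(ltW qb0).
move=> fx; have [dx _] := fx; move: dx; rewrite /defect mz mulr0 addr0.
have -> : (1 - q) / B ^+ 2 / (1 - q) = B^-1 ^+ 2.
  by field; rewrite !gt_eqF.
rewrite sqrtr_sqr ger0_norm ?invr_ge0 ?(ltW B0)//.
have := a0 _ fx; rewrite !e -/B mulVf ?gt_eqF// => h2 h3.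
have : 0 < 0 :> K by lra.
by rewrite ltxx.
Qed.

Lemma near_forall_lt (n : nat) (P : nat -> K -> Prop) (x : K) :
  (forall k, (k < n)%N -> \forall y \near x, P k y) ->
  \forall y \near x, forall k, (k < n)%N -> P k y.
Proof.
elim: n => [_|n IH h]; first by near=> y => k.
have h1 := IH (fun k kn => h k (ltnW kn)); have h2 := h n (ltnSn n).
near=> y => k; rewrite ltnS leq_eqVlt => /orP[/eqP->|kn].
  by near: y.
by move: k kn; near: y.
Unshelve. all: by end_near. Qed.

Lemma feasible_open x : feasible x -> \forall y \near x, feasible y.
Proof.
move=> [dx h].
have n1 : \forall y \near x, defect y < 0.
  exact: (@cvgr_lt K K (nbhs x) _ defect (defect x) (@defect_continuous x) 0 dx).
have n2 : \forall y \near x, forall k, (k < N.+1)%N -> (1 <= k)%N ->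
    a y k < 1 /\ (q = 0 \/ 0 < b y k).
  apply: near_forall_lt => k kN; case: (ltnP 0 k) => [k1|k0]; last first.
    by near=> y.
  have kN' : (1 <= k <= N)%N by rewrite k1.
  have [h1 h2] := h k kN'.
  have n3 : \forall y \near x, a y k < 1.
    exact: (@cvgr_lt K K (nbhs x) _ (fun y => a y k) (a x k) (a_continuous kN (x := x)) 1 h1).
  case: h2 => [qe|h2].
    by near=> y => _; split; [near: y | left].
  have n4 : \forall y \near x, 0 < b y k.
    exact: (@cvgr_gt K K (nbhs x) _ (fun y => b y k) (b x k) (b_continuous kN (x := x)) 0 h2).
  by near=> y => _; split; [near: y | right; near: y].
near=> y; split; first by near: y.
move=> k /andP[k1 kN].
have : forall k, (k < N.+1)%N -> (1 <= k)%N -> a y k < 1 /\ (q = 0 \/ 0 < b y k).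
  by near: y.
exact.
Unshelve. all: by end_near. Qed.

Lemma left_limit_le (g : K -> K) (s : K) : 0 < s -> continuous g ->
  (forall y, 0 <= y < s -> g y <= 0) -> g s <= 0.
Proof.
move=> s0 cg h; rewrite leNgt; apply/negP => gs.
have : \forall y \near s, 0 < g y
  by exact: (@cvgr_gt K K (nbhs s) _ g (g s) (cg s) 0 gs).
move=> /nbhs_ballP[e /= e0 be].
pose y := Num.max (s - e / 2) (s / 2).
have ys : y < s by rewrite gt_max; apply/andP; split; lra.
have y0 : 0 <= y by rewrite le_max; apply/orP; right; lra.
have ye : s - e / 2 <= y by rewrite le_max lexx.
have := h y; rewrite y0 ys => /(_ isT); rewrite leNgt => /negP; apply.
apply: be; rewrite /ball /= ger0_norm; lra.
Qed.

Lemma first_exit : exists s, [/\ 0 < s, ~ feasible s &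
  forall y, 0 <= y < s -> feasible y].
Proof.
pose S : set K := [set x | 0 <= x /\ forall y, 0 <= y <= x -> feasible y].
have [m m0 nm] := infeasible_point.
have S0 : S 0.
  split=> // y h; suff -> : y = 0 by exact: feasible0.
  by apply/eqP; rewrite eq_le andbC.
have Sm : ubound S m.
  move=> x [x0 h]; rewrite leNgt; apply/negP => mx; apply: nm; apply: h.
  by rewrite m0 ltW.
have hS : has_sup S by split; [exists 0 | exists m].
pose s := sup S.
have s0 : 0 <= s by apply: sup_upper_bound.
have below y : 0 <= y < s -> feasible y.
  move=> /andP[y0 ys].
  have sy : 0 < s - y by rewrite subr_gt0.
  have [x [x0 hx] yx] := sup_adherent sy hS.
  by apply: hx; rewrite y0 /=; move: yx; rewrite -/s; lra.
have ns : ~ feasible s.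
  move=> fs; have /nbhs_ballP[e /= e0 be] := feasible_open fs.
  suff : S (s + e / 2).
    move=> /(sup_upper_bound hS); rewrite -/s; lra.
  split; first by rewrite addr_ge0// divr_ge0// ltW.
  move=> y /andP[y0 ye]; have [ys|sy] := ltP y s; first by apply: below; rewrite y0.
  apply: be; rewrite /ball /= distrC ger0_norm ?subr_ge0//; lra.
exists s; split=> //; rewrite lt_neqAle s0 andbT; apply/eqP => e.
by apply: ns; rewrite -e; exact: feasible0.
Qed.

(* At the first exit of the feasible region every strict inequality other than
   [defect < 0] still holds, so the defect must vanish there. *)
Lemma risk_coefficient_exists : exists eta, risk_coefficient N q wx wf eta.
Proof.
have [s [s0 ns below]] := first_exit.
have wo : weakly_ordered N q (r s).
  move=> k kN; have /andP[_ kN'] := kN; split.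
    rewrite -subr_le0; apply: (@left_limit_le (fun x => a x k + - 1) s) => //.
      exact: continuousDf (a_continuous kN') (@continuous_cst _ _).
    by move=> y /below/feasible_weak/(_ k kN)[h _]; rewrite subr_le0.
  rewrite -oppr_le0 -mulN1r.
  apply: (@left_limit_le (fun x => -1 * b x k) s) => //.
    exact: continuousMf (@continuous_cst _ _) (b_continuous kN').
  by move=> y /below/feasible_weak/(_ k kN)[_ h]; rewrite mulN1r oppr_le0.
have ds : defect s <= 0.
  by apply: (left_limit_le s0 defect_continuous) => y /below[/ltW].
have rq : q <= r s.
  rewrite -subr_le0 -mulN1r; apply: (@left_limit_le (fun x => q + -1 * r x) s) => //.
  - apply: continuousDf (@continuous_cst _ _) _.
    exact: continuousMf (@continuous_cst _ _) rcoef_continuous.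
  - move=> y h; have /andP[y0 _] := h; rewrite mulN1r subr_le0.
    exact: feasible_r_ge y0 (below y h).
have rs := rcoef_sqr (ltW s0) wo ds; have lo := rsq_lower (ltW s0) wo ds.
have a1 := weak_ge_r q0 q1 (r0 s) wo (k := 1%N) N1.
have swx : 0 <= s * wx by rewrite mulr_ge0// ltW.
have sq0 : 0 < rsq q wx wf s.
  (* For q > 0 the uniform bound r >= q decides; otherwise w_x > 0 makes the term s w_x of
     [rsq_lower] positive. *)
  have [qp|/negP] := boolP (0 < q).
    by rewrite -rs exprn_gt0// (lt_le_trans qp).
  case: hqw => [//|wxp _]; apply: lt_le_trans lo.
  by rewrite ltr_wpDl ?mulr_gt0// mulr_ge0// (le_trans (r0 s)).
have rp : 0 < r s by rewrite sqrtr_gt0.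
have a1p := lt_le_trans rp a1.
have [_ b1] := wo 1%N N1.
(* If a_1 >= 1, the nonpositive defect forces s w_x = s w_f = 0, so r is sqrt q as at the start,
   where a_1 < 1. *)
have a1lt : a s 1 < 1.
  rewrite ltNge; apply/negP => a1ge.
  have h := mulr_ge0 (sqrtr_ge0 (s / (1 - q))) b1.
  have swf : 0 <= s * wf by rewrite mulr_ge0// ltW.
  have swx0 : s * wx = 0 by move: ds; rewrite /defect; lra.
  have swf0 : s * wf = 0 by move: ds; rewrite /defect; lra.
  have [/andP[_ +] _] := start_ordered q0 q1 N1.
  by rewrite -(r_at0 swx0 swf0) ltNge a1ge.
(* b_1^2 = r^2 - q a_1^2 is at least q a_1 (1 - a_1) + s w_x by [rsq_lower]. *)
have b1p : 0 < b s 1.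
  suff : 0 < b s 1 ^+ 2.
    move=> h; rewrite lt_neqAle b1 andbT.
    by apply: contraTneq h => <-; rewrite expr0n ltxx.
  rewrite (weak_pb_sqr q0 q1 (r0 s) wo)// rs.
  have : 0 < q * a s 1 * (1 - a s 1) + s * wx.
    have h : 0 <= q * a s 1 * (1 - a s 1).
      by rewrite !mulr_ge0 ?subr_ge0 ?(ltW a1p) ?(ltW a1lt).
    case: hqw => [qp|wxp].
      by rewrite ltr_pwDl// !mulr_gt0 ?subr_gt0.
    by rewrite ltr_wpDl// mulr_gt0.
  by move: lo; lra.
have ord := weak_ordered q0 q1 N1 (r0 s) wo rp a1lt b1p.
have dz : defect s = 0.
  apply/eqP; rewrite eq_le ds /= leNgt; apply/negP => dn; apply: ns; split=> // k kN.
  by split; [exact: pa_lt1 ord _ kN | right; exact: pb_gt0 q0 q1 ord _ kN].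
exists s; split=> //; first exact: ltW.
  split=> //; rewrite rp /=.
  by have := pa_lt1 ord (k := N); rewrite N1 leqnn pa_last => /(_ isT).
by move/eqP: dz; rewrite subr_eq0 => /eqP.
Qed.

End Existence.

Unset Implicit Arguments.

Theorem theorem2p3 (K : realType) (L mu : K) (N : nat) (wx wf wg : K)
  (hL : 0 < L) (hmu : 0 <= mu < L) (hN : (1 <= N)%N)
  (hwx : 0 <= wx) (hwf : 0 <= wf) (hwg : 0 <= wg) (hw : wx + wf + wg = 1)
  (hqw : 0 < mu / L \/ 0 < wx) :
  exists eta : K,
    [/\ risk_coefficient N (mu / L) wx wf eta,
        forall eta' : K, risk_coefficient N (mu / L) wx wf eta' -> eta' = eta,
        forall (R : K) (d : nat), 0 < R -> (2 * N + 1 <= d)%N ->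
          minimax_risk N (@instance_class K d mu L wx wf wg R) =
            (L / 2 * eta * R ^+ 2)%:E
      & forall (d : nat) (R : K) (f : 'rV[K]_d -> K) (x0 : 'rV[K]_d),
          (1 <= d)%N -> 0 < R ->
          instance_class mu L wx wf wg R (f, x0) ->
          f (item_output N (mu / L) wx wf L eta f x0) - fmin f
            <= L / 2 * eta * R ^+ 2].
Proof.
have q0 : 0 <= mu / L by have /andP[h _] := hmu; rewrite divr_ge0// ltW.
have q1 : mu / L < 1 by have /andP[_ h] := hmu; rewrite ltr_pdivrMr// mul1r.
have [eta rc] := risk_coefficient_exists q0 q1 hN hwx hwf hqw.
have riskE x (rx : risk_coefficient N (mu / L) wx wf x) :=
  minimax_riskE hL hmu hN hwx hwf hwg hw rx.
exists eta; split=> // [eta' rc'|R d R0 dN|d R f x0 _ R0 fx].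
(* Comparing the two values of the risk at R = 1 in dimension 2 N + 1 is enough. *)
- have := riskE eta' rc' 1 _ ltr01 (leqnn _).
  rewrite (riskE eta rc 1 _ ltr01 (leqnn _)) !expr1n !mulr1 => -[].
  by move=> /mulfI-> //; rewrite gt_eqF// divr_gt0.
- exact: riskE.
- by have := item_bound hL hmu hN hwx hw rc fx.
Qed.
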